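(* Let $\Gamma$ be a finite connected simple graph and let $G \leqslant \mathrm{Aut}(\Gamma)$ be arc-transitive. Suppose that for every vertex $v$ of $\Gamma$ the permutation group $G_v^{\Gamma(v)}$ is semiprimitive and has a regular normal nilpotent subgroup, and that $G_{xy}^{[1]}\neq 1$ for some edge $\{x,y\}$ of $\Gamma$. Let $p$ be a prime dividing $|G_{xy}^{[1]}|$. Let $K = G_x^{\Gamma(x)}$ and let $R$ be the regular normal nilpotent subgroup of $K$. Then $K$ contains normal subgroups $J$ and $F$ such that $F < R < J$ (strict inclusions) and one of the following holds: (1) $p=2$ and $J/F \cong \mathrm{Sym}(3) \times \dots \times \mathrm{Sym}(3)$; (2) $p=3$ and $J/F \cong \mathrm{Alt}(4) \times \dots \times \mathrm{Alt}(4)$ (a direct product of some number of copies in each case).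
   Context: For a vertex $v$ of $\Gamma$, $\Gamma(v)$ is the set of neighbours of $v$, $G_v$ is the stabiliser of $v$, and $G_v^{\Gamma(v)}$ is the permutation group induced by $G_v$ on $\Gamma(v)$. For an edge $\{x,y\}$, $G_{xy}^{[1]}$ is the kernel of the action of the edge stabiliser $G_{\{x,y\}}$ on $\Gamma(x)\cup\Gamma(y)$. $G$ is arc-transitive if it is transitive on ordered pairs of adjacent vertices. A subgroup $N$ of a permutation group on $\Omega$ is semiregular if $N_\omega=1$ for all $\omega\in\Omega$, and regular if it is transitive and semiregular. A permutation group is semiprimitive if it is transitive and every normal subgroup of it is transitive or semiregular. (The regular normal nilpotent subgroup of such a semiprimitive group is unique.) *)

(* Defs.v *)
From HB Require Import structures.
From mathcomp Require Import all_boot all_fingroup all_solvable.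

Set Implicit Arguments.
Unset Strict Implicit.
Unset Printing Implicit Defensive.

Local Open Scope group_scope.

(* A permutation group on a subset S of T is represented as a group of          *)
(* permutations of T supported on S, as in Sym S and restr_perm S.              *)
Section PermGroups.

Variables (T : finType) (S : {set T}).
Implicit Types H N R : {group {perm T}}.

(* Not frobenius.semiregular, which is about a group acting by conjugation.     *)
Definition semiregular_on N : Prop := {in S, forall w, 'C_N[w | 'P] = 1}.

Definition regular_on N : Prop := [transitive N, on S | 'P] /\ semiregular_on N.

Definition semiprimitive H : Prop :=
  [transitive H, on S | 'P] /\
  forall N, N <| H -> [transitive N, on S | 'P] \/ semiregular_on N.

Definition regular_normal_nilpotent H R : Prop :=
  [/\ R <| H, regular_on R & nilpotent R].

End PermGroups.

Section Graphs.

Variables (T : finType) (e : rel T).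
Implicit Type G : {group {perm T}}.

Definition simple_graph : Prop := symmetric e /\ irreflexive e.

Definition connected_graph : Prop := forall x y, connect e x y.

Definition graph_aut : {set {perm T}} :=
  [set g : {perm T} | [forall x, forall y, e (g x) (g y) == e x y]].

Definition nbrs (v : T) : {set T} := [set w | e v w].

Definition arc_transitive G : Prop :=
  forall x y x' y', e x y -> e x' y' ->
  exists2 g, g \in G & g x = x' /\ g y = y'.

(* G_v^{Gamma(v)}; for G \subset graph_aut, the stabiliser of v lies in the     *)
(* domain 'N(nbrs v | 'P) of the morphism restr_perm (nbrs v).                  *)
Definition local_group G (v : T) : {group {perm T}} :=
  (restr_perm (nbrs v) @* 'C_G[v | 'P])%G.

(* G_{xy}^{[1]}; 'N_G([set x; y] | 'P) is the setwise stabiliser of {x, y}.     *)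
Definition edge_kernel G (x y : T) : {group {perm T}} :=
  ('C_('N_G([set x; y] | 'P))(nbrs x :|: nbrs y | 'P))%G.

End Graphs.

(* External direct product of k copies of H. *)
Definition direct_power (gT : finGroupType) (k : nat) (H : {group gT}) :
    {group {dffun forall i : 'I_k, gT}} :=
  setXn_group (fun _ : 'I_k => H).

(* Main.v *)
(** Let P = G_x, B = G_xy, N = G_x^[1], X the preimage of R in P, and let tau in
    G swap x and y.  A subgroup of B normalised by tau and by a subgroup of P
    transitive on Gamma(x) is trivial, and a normal subgroup M of P satisfies
    MB = P or M :&: B <= N.  A Thompson-Wielandt argument shows that
    D = N :&: N^tau is a p-group and that O_p(N) is not contained in N^tau.
    Then O = O_p(B) does not lie in Q = O_p(N), and with V = Ohm_1(Z(Q)) and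
    C = C_P(V), the Thompson subgroup trick gives an elementary abelian A <= O
    outside Q with #|V : C_V(A)| <= #|A : A :&: Q|.  In P / C acting on V there
    is a nilpotent p'-group Y with YN = X modulo C on which O / Q acts
    faithfully; a minimal offender inside A is generated by a transvection.  If
    a transvection group E of V does not centralise a nilpotent p'-group Y that
    it normalises, then [V, [Y, E]] is a plane, and looking at its p + 1 lines
    forces p <= 3.  If F is maximal among the normal subgroups of P with
    CN <= F < X, the B-conjugates of that transvection commute and act on the
    abelian group W = X / F as reflections with commutator of order p + 1, so
    that W extended by them is a direct product of copies of Sym(3) or Alt(4). *)

Require Import Defs.
From HB Require Import structures.
From mathcomp Require Import all_boot all_fingroup all_solvable.
From mathcomp Require Import ssralg zmodp matrix mxalgebra mxrepresentation mxabelem.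

Set Implicit Arguments.
Unset Strict Implicit.
Unset Printing Implicit Defensive.

Local Open Scope group_scope.

(** * Coprime action and offenders *)

Section CoprimeAction.

Variable gT : finGroupType.
Implicit Types A B C G H K U V Y : {group gT}.

(** The constant p + 1 counts the lines of the plane: [[~: Y, E]] permutes them transitively, and
    the stabiliser of the line fixed by E is the centraliser of E in it. On the abelian section W
    this centraliser dies, because E has no fixed points on [[~: W, E]]; so [[~: W, E]] has order
    dividing p + 1, and a nontrivial order congruent to 1 modulo p cannot be smaller. The bound on p
    comes from nilpotence, which makes the line stabiliser central: E then permutes transitively the
    nontrivial elements of a quotient of order p + 1, for odd p an elementary abelian 2-group, and
    counting centralisers bounds that order by 4. The obstacle is that X / N is nilpotent while X
    need not be, yet the plane argument needs a nilpotent p'-group acting on V. The subgroup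
    [[~: X, O]] supplies it: [[~: N, O]] lies in [O :&: N], which is Q and acts trivially on V, so
    the image of [[~: X, O]] centralises the image of N and is nilpotent. Semiprimitivity reaches
    the sections of X through [quotient_faithful]: a subgroup of B acting trivially on a proper
    quotient of X above N lies in N. *)

Lemma coprime_cent_prod A G :
  A \subset 'N(G) -> coprime #|G| #|A| -> solvable G ->
  [~: G, A] * 'C_G(A) = G.
Proof.
move=> nGA coGA solG; have sRG: [~: G, A] \subset G by rewrite commg_subl.
apply/eqP; rewrite eqEsubset mul_subG ?subsetIl //=.
rewrite -quotientSK ?commg_norml // coprime_quotient_cent ?commg_normr //.
by rewrite subsetI subxx quotient_cents2r.
Qed.

Lemma coprime_commGid A G :
  A \subset 'N(G) -> coprime #|G| #|A| -> solvable G ->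
  [~: G, A, A] = [~: G, A].
Proof.
move=> nGA coGA solG; apply/eqP; rewrite eqEsubset commSg ?commg_subl //=.
have nAC: 'C_G(A) \subset 'N([~: G, A, A]).
  by rewrite normsR ?subIset ?commg_norml ?cent_sub ?orbT.
rewrite -{1}(coprime_cent_prod nGA coGA solG) commMG //.
by rewrite (commG1P (subsetIr G 'C(A))) mulg1.
Qed.

Lemma coprime_stab_chain A G H :
  A \subset 'N(G) -> coprime #|G| #|A| -> solvable G ->
  [~: G, A] \subset H -> A \subset 'C(H) -> A \subset 'C(G).
Proof.
move=> nGA coGA solG sRH cHA.
rewrite centsC; apply/commG1P; rewrite -coprime_commGid //.
by apply/commG1P; rewrite (subset_trans sRH) // centsC.
Qed.

Lemma minnormal_abelian_quo_cyclic r A G :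
    r.-abelem G -> abelian A -> minnormal G A -> cyclic (A / 'C_A(G)).
Proof.
move=> abelG cAA minG; have /andP[ntG nGA] := mingroupp minG.
pose rG : mx_representation 'F_r A _ := abelem_repr abelG ntG nGA.
have irrG : mx_irreducible rG by apply/abelem_mx_irrP.
rewrite -(rker_abelem abelG ntG nGA).
apply: mx_faithful_irr_abelian_cyclic (kquo_mx_faithful rG) _ _.
  exact/quo_mx_irr.
exact: quotient_abelian.
Qed.

Lemma abelem_cyclic_index p A B :
  prime p -> p.-abelem A -> B \subset A -> cyclic (A / B) -> #|A : B| <= p.
Proof.
move=> p_pr abelA sBA cycAB.
have nBA: A \subset 'N(B) by rewrite sub_abelian_norm ?(abelem_abelian abelA).
have [_ ABp] := abelemP p_pr (quotient_abelem B abelA).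
rewrite -card_quotient //; have /cyclicP[x defAB] := cycAB.
have ->: #|A / B| = #[x] by rewrite orderE -defAB.
by rewrite dvdn_leq ?prime_gt0 // order_dvdn ABp //= defAB cycle_id.
Qed.

End CoprimeAction.

(** This is generation of Y by the ['C_Y(B)], phrased so that it passes to sections. If Y is itself
    minimal normal, the abelian group A acts on it through a cyclic group, so ['C_A(Y)] is one of
    the B; otherwise A centralises M and Y / M by induction, and coprimeness glues. *)
Lemma coprime_cent_hyperplanes (gT : finGroupType) p (A Y : {group gT}) :
    prime p -> p.-abelem A -> A \subset 'N(Y) -> coprime #|Y| #|A| ->
    solvable Y ->
    (forall B : {group gT},
       B \subset A -> #|A : B| <= p -> 'C_Y(B) \subset 'C(A)) ->
  Y \subset 'C(A).
Proof.
move=> p_pr; have [n] := ubnP #|Y|; elim: n gT A Y => // n IHn rT A Y /ltnSE-leYn.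
move=> abelA nYA coYA solY genY; have cAA := abelem_abelian abelA.
have [-> | ntY] := eqVneq (Y : {set _}) 1; first exact: sub1G.
have [M minM sMY]: {M : {group rT} | minnormal M (Y <*> A) & M \subset Y}.
  by apply: minnormal_exists => //; rewrite join_subG normG.
have [nMYA ntM /is_abelemP[r r_pr abelM]] := minnormal_solvable minM sMY solY.
have [nMY nMA] := joing_subP nMYA.
have [eqMY | neMY] := eqVneq (M : {set _}) Y; last first.
  have ltMY : M \proper Y by rewrite properEneq neMY.
  have cMA: M \subset 'C(A).
    apply: (IHn _ A) => //.
    - exact: leq_trans (proper_card ltMY) leYn.
    - exact: coprimeSg coYA.
    - exact: solvableS solY.
    by move=> B sBA iB; apply: subset_trans (genY B sBA iB); rewrite setSI.
  have tiMA: A :&: M = 1 by rewrite setIC coprime_TIg // (coprimeSg sMY).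
  have cQA: Y / M \subset 'C(A / M).
    apply: IHn => //=.
    - by apply: leq_trans leYn; rewrite ltn_quotient.
    - exact: quotient_abelem.
    - exact: quotient_norms.
    - exact: coprime_morph.
    - exact: quotient_sol.
    move=> Bb sBb; pose B := (A :&: coset M @*^-1 Bb)%G.
    have sBA: B \subset A := subsetIl _ _.
    have ->: Bb = (B / M)%G.
      apply: val_inj; rewrite /= quotientIG ?sub_cosetpre ?cosetpreK //.
      exact/esym/setIidPr.
    rewrite index_quotient_eq ?tiMA ?sub1G // => iB.
    rewrite -coprime_quotient_cent ?(coprimegS sBA) ?(subset_trans sBA) //.
    by rewrite quotient_cents // genY.
  rewrite centsC; apply: coprime_stab_chain nYA coYA solY _ _ ; last first.
    by rewrite centsC; apply: cMA.
  by rewrite -quotient_cents2.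
rewrite -eqMY in genY nYA *.
apply: subset_trans (genY _ (subsetIl A 'C(M)) _); last first.
  apply: abelem_cyclic_index => //; first exact: subsetIl.
  apply: (minnormal_abelian_quo_cyclic abelM cAA).
  apply/mingroupP; split=> [|H /andP[ntH nHA] sHM]; first by rewrite ntM.
  have [_ minM'] := mingroupP minM; apply: minM' => //; rewrite ntH join_subG nHA andbT.
  by rewrite -eqMY sub_abelian_norm // (abelem_abelian abelM).
by rewrite subsetI subxx centsC subsetIr.
Qed.

Section QuadraticAction.

Variables (gT : finGroupType) (p : nat).
Hypothesis p_pr : prime p.
Implicit Types A B G K U V W X Y : {group gT}.

Lemma pgroup_cent_neq1 A W :
  p.-group A -> p.-group W -> A \subset 'N(W) -> W :!=: 1 -> 'C_W(A) != 1.
Proof.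
move=> pA pW nWA ntW; have nilWA: nilpotent (W <*> A).
  by rewrite (pgroup_nil (_ : p.-group _)) //= norm_joinEr // pgroupM pW.
have /meet_center_nil := nilWA => /(_ W); rewrite /normal joing_subl join_subG.
rewrite normG nWA => /(_ isT ntW); apply: contraNneq => /trivgP C1.
rewrite -subG1 (subset_trans _ C1) // setIS // subIset // orbC.
by rewrite centS ?joing_subr.
Qed.

(** Thompson's A x B lemma. B acts on [[~: V, X]]; were this nontrivial, B would fix a nontrivial
    element of it, and X would centralise that element, against [[~: V, X] :&: 'C_V(X) = 1]. *)
Lemma coprime_pgroup_cent B X V :
    p.-abelem V -> p.-group B -> p^'.-group X -> B \subset 'N(V) ->
    X \subset 'N(V) -> X \subset 'C(B) -> 'C_V(B) \subset 'C(X) ->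
  X \subset 'C(V).
Proof.
move=> abelV pB p'X nVB nVX cBX cVB; have [pV cVV _] := and3P abelV.
have coVX: coprime #|V| #|X| := pnat_coprime pV p'X.
rewrite centsC; apply/commG1P/eqP/idPn => ntR.
have sRV: [~: V, X] \subset V by rewrite commg_subl.
have nRB: B \subset 'N([~: V, X]) by rewrite normsR // cents_norm // centsC.
have /negP[] := pgroup_cent_neq1 pB (pgroupS sRV pV) nRB ntR.
rewrite -subG1 -(coprime_abel_cent_TI nVX coVX cVV) subsetI subsetIl.
by rewrite (subset_trans _ cVB) ?setSI.
Qed.

(* A minimal offender has order p: otherwise every hyperplane B of A satisfies
   'C_V(B) = 'C_V(A), whence [~: 'C_Y(B), A] = 1, and Y is generated by the
   'C_Y(B). *)
Lemma offender_transvection A V Y :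
    p.-abelem V -> p.-abelem A -> A \subset 'N(V) -> Y \subset 'N(V) ->
    A \subset 'N(Y) -> p^'.-group Y -> solvable Y -> 'C_Y(V) = 1 ->
    'C_A(Y) = 1 -> A :!=: 1 -> #|V : 'C_V(A)| <= #|A| ->
  exists t, [/\ t \in A, t != 1 & #|V : 'C_V[t]| <= p].
Proof.
move=> abelV; have [n] := ubnP #|A|; elim: n A => // n IHn A /ltnSE-leAn.
move=> abelA nVA nVY nYA p'Y solY faithY faithA ntA offA.
have [pA cAA _] := and3P abelA; have [pV cVV _] := and3P abelV.
have coYA: coprime #|Y| #|A| by rewrite coprime_sym (pnat_coprime pA).
have [leAp | ltpA] := leqP #|A| p.
  have [t At ntt] := trivgPn _ ntA; exists t; split=> //.
  suffices <-: 'C_V(A) = 'C_V[t] by apply: leq_trans leAp.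
  suffices ->: A :=: <[t]> by rewrite cent_cycle.
  apply/eqP; rewrite eq_sym eqEcard cycle_subG At (leq_trans leAp) //.
  by rewrite -orderE (abelem_order_p abelA).
have [/exists_inP[B ltBA /andP[ntB offB]] | noB] :=
  boolP [exists (B : {group gT} | B \proper A), (B :!=: 1) && (#|V : 'C_V(B)| <= #|B|)].
  have sBA := proper_sub ltBA.
  have [||t [Bt ntt tV]] := IHn B _ (abelemS sBA abelA) (subset_trans sBA nVA)
    nVY (subset_trans sBA nYA) p'Y solY faithY _ ntB offB.
  - exact: leq_trans (proper_card ltBA) leAn.
  - by apply/trivgP; rewrite -faithA setSI.
  by exists t; rewrite (subsetP sBA).
case/negP: ntA; rewrite -subG1 -faithA subsetI subxx centsC.
apply: (coprime_cent_hyperplanes p_pr abelA) => // B sBA iAB.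
have [-> | neBA] := eqVneq (B : {set _}) A; first exact: subsetIr.
have ltBA: B \proper A by rewrite properEneq neBA.
have [[pB nVB] nYB] := (pgroupS sBA pA, subset_trans sBA nVA, subset_trans sBA nYA).
have ntB: B :!=: 1.
  by apply: contraTneq iAB => ->; rewrite indexg1 -ltnNge.
have{noB}: #|B| < #|V : 'C_V(B)|.
  by rewrite ltnNge; apply: contra noB => offB; apply/exists_inP; exists B; rewrite // ntB.
have sCAB: 'C_V(A) \subset 'C_V(B) by rewrite setIS ?centS.
have pi: p.-nat #|V : 'C_V(B)| by rewrite (pnat_dvd (dvdn_indexg _ _)).
have [_ _ [b oB]] := pgroup_pdiv pB ntB.
case/p_natP: pi => c oc.
rewrite oB oc ltn_exp2l ?prime_gt1 // => ltbc.
(* The index of ['C_V(B)] is a power of p larger than [#|B|], hence at least [p * #|B|], hence at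
   least [#|A|], which bounds the index of ['C_V(A)]. *)
have eqC: 'C_V(A) = 'C_V(B).
  apply/eqP; rewrite eqEcard sCAB /= -(leq_pmul2r (indexg_gt0 V 'C_V(A))).
  rewrite Lagrange ?subsetIl // -(Lagrange (subsetIl V 'C(B))) leq_mul2l /=.
  apply/orP; right; apply: leq_trans offA _.
  rewrite -(Lagrange sBA) oB oc (@leq_trans (p ^ b.+2)) ?leq_exp2l ?prime_gt1 //.
  by rewrite [(p ^ b.+2)%N]expnSr leq_mul2l iAB orbT.
set X := [~: 'C_Y(B), A].
have nCA: A \subset 'N('C_Y(B)).
  by rewrite normsI // norms_cent // cents_norm // (subset_trans cAA) ?centS.
have sXC: X \subset 'C_Y(B) by rewrite commg_subl.
(* ['C_V(B)] equals ['C_V(A)], so A centralises it while ['C_Y(B)] normalises it; therefore their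
   commutator X centralises it, as the A x B lemma requires. *)
have cXV: X \subset 'C(V).
  apply: (@coprime_pgroup_cent B) => //.
  - exact: pgroupS (subset_trans sXC (subsetIl _ _)) p'Y.
  - exact: subset_trans (subset_trans sXC (subsetIl _ _)) nVY.
  - exact: subset_trans sXC (subsetIr _ _).
  rewrite centsC; apply: comm_norm_cent_cent => //=.
    by rewrite -eqC centsC subsetIr.
  rewrite normsI //; first by rewrite subIset ?nVY.
  exact: subset_trans (subsetIr _ _) (normG _).
apply/commG1P/trivgP; rewrite -faithY subsetI cXV andbT.
exact: subset_trans sXC (subsetIl _ _).
Qed.

End QuadraticAction.

Lemma comm_norm_cent_mod (gT : finGroupType) (A E U Z : {group gT}) :
    A \subset 'N(Z) -> E \subset 'N(Z) -> U \subset 'N(Z) -> A \subset 'N(U) ->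
    E \subset 'N(A) -> [~: U, E] \subset Z ->
  [~: U, [~: A, E]] \subset Z.
Proof.
move=> nZA nZE nZU nUA nAE sUEZ.
have nZAE: [~: A, E] \subset 'N(Z) by rewrite comm_subG.
rewrite commGC -quotient_cents2 // quotientR //.
apply: comm_norm_cent_cent; rewrite ?quotient_norms //.
by rewrite quotient_cents2 // commGC.
Qed.

(** * Transvections on a plane *)

Section PlaneAction.

Variables (gT : finGroupType) (p : nat) (U K E : {group gT}).
Hypotheses (p_pr : prime p) (abelU : p.-abelem U) (oU : #|U| = (p ^ 2)%N).
Hypotheses (nUK : K \subset 'N(U)) (p'K : p^'.-group K) (faithK : 'C_K(U) = 1).
Hypotheses (nilK : nilpotent K) (ntK : K :!=: 1).
Hypotheses (oE : #|E| = p) (nUE : E \subset 'N(U)) (nKE : E \subset 'N(K)).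
Hypothesis KE_K : [~: K, E] = K.

Let Z := 'C_U(E)%G.

Let pU : p.-group U := abelem_pgroup abelU.
Let pE : p.-group E. Proof. by rewrite /pgroup oE pnat_id. Qed.
Let sZU : Z \subset U := subsetIl _ _.
Let coUK : coprime #|U| #|K|. Proof. exact: pnat_coprime pU p'K. Qed.

Let coKE : coprime #|K| #|E|.
Proof. by rewrite coprime_sym (pnat_coprime pE). Qed.

Lemma plane_not_cent : ~~ (E \subset 'C(U)).
Proof.
apply: contra ntK => cUE; rewrite -subG1 -faithK subsetI subxx /= -KE_K.
exact: comm_norm_cent_cent.
Qed.

Lemma card_plane_cent : #|Z| = p.
Proof.
have ntU: U :!=: 1 by rewrite -cardG_gt1 oU (ltn_exp2l 0) ?prime_gt1.
have ntZ: Z :!=: 1 := pgroup_cent_neq1 pE pU nUE ntU.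
have neZU: Z :!=: U.
  apply: contra plane_not_cent => /eqP eqZU.
  by rewrite centsC -{1}eqZU subsetIr.
have [_ _ [b oZ]] := pgroup_pdiv (pgroupS sZU pU) ntZ.
have: #|Z| < #|U| by rewrite proper_card // properEneq neZU.
by rewrite oZ oU ltn_exp2l ?prime_gt1 //; case: b {oZ}.
Qed.

Lemma plane_comm_sub : [~: U, E] \subset Z.
Proof.
have ntR: [~: U, E] != 1.
  by apply: contra plane_not_cent => /eqP/commG1P; rewrite centsC.
have sRU: [~: U, E] \subset U by rewrite commg_subl.
have pR := pgroupS sRU pU.
have nRE: E \subset 'N([~: U, E]) by apply: commg_normr.
have ntCR := pgroup_cent_neq1 pE pR nRE ntR.
have nilUE: nilpotent (U <*> E).
  by rewrite (pgroup_nil (_ : p.-group _)) //= norm_joinEr // pgroupM pU.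
have ltRU: [~: U, E] \proper U.
  apply: nil_comm_properl nilUE (joing_subl _ _) _ _.
    by rewrite -cardG_gt1 oU (ltn_exp2l 0) ?prime_gt1.
  by rewrite subsetI joing_subr.
have [_ _ [b oR]] := pgroup_pdiv pR ntR.
have [_ _ [c oC]] := pgroup_pdiv (pgroupS (subsetIl _ _) pR) ntCR.
suffices <-: 'C_[~: U, E](E) = [~: U, E] by rewrite setSI.
apply/eqP; rewrite eqEcard subsetIl oR oC leq_exp2l ?prime_gt1 //.
by move: (proper_card ltRU); rewrite oR oU ltn_exp2l ?prime_gt1 //; case: b {oR}.
Qed.

Local Notation lines := ('E_p^1(U)).

Lemma card_lines : #|lines| = p.+1.
Proof.
suffices U2: U \in 'E_p^2(U) by rewrite (card_p1Elem_p2Elem U2).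
by rewrite pnElemE // !inE subxx abelU oU /=.
Qed.

Lemma mem_line_cent : Z \in lines.
Proof. by rewrite p1ElemE // !inE sZU card_plane_cent /=. Qed.

Lemma line_normalised_eq L : L \in lines -> E \subset 'N(L) -> L = Z.
Proof.
rewrite p1ElemE // !inE => /andP[sLU /eqP oL] nLE.
have pL := pgroupS sLU pU.
have ntL: L :!=: 1 by rewrite -cardG_gt1 oL prime_gt1.
have ntC := pgroup_cent_neq1 pE pL nLE ntL.
have [_ _ [b oC]] := pgroup_pdiv (pgroupS (subsetIl _ _) pL) ntC.
have sLZ: L \subset Z.
  suffices <-: 'C_L(E) = L by rewrite setSI.
  apply/eqP; rewrite eqEcard subsetIl oL oC.
  by rewrite expnS leq_pmulr ?expn_gt0 ?prime_gt0.
by apply/val_inj/eqP; rewrite /= eqEcard sLZ oL -/Z card_plane_cent leqnn.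
Qed.

(** [[~: A, E]] stabilises the chain 1 < Z < U: E acts trivially on U / Z and on Z, and A normalises
    both terms. A p'-group stabilising such a chain acts trivially. *)
Lemma comm_chain_trivial (A : {group gT}) :
  A \subset K -> E \subset 'N(A) -> A \subset 'N(Z) -> [~: A, E] = 1.
Proof.
move=> sAK nAE nZA; apply/trivgP; rewrite -faithK subsetI.
rewrite (subset_trans (commSg E sAK)) ?commg_subl //=.
have sRK: [~: A, E] \subset K by rewrite (subset_trans (commSg E sAK)) ?commg_subl.
have nZE: E \subset 'N(Z) by rewrite normsI // norms_cent ?normG.
have nZU: U \subset 'N(Z).
  by rewrite sub_abelian_norm ?(abelem_abelian abelU).
apply: (@coprime_stab_chain _ _ U Z) => /=.
- exact: subset_trans sRK nUK.
- exact: coprimegS sRK _.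
- exact: abelian_sol (abelem_abelian abelU).
- apply: comm_norm_cent_mod plane_comm_sub => //.
  exact: subset_trans sAK nUK.
apply: comm_norm_cent_cent => //.
by rewrite centsC subsetIr.
Qed.

Lemma acts_lines (A : {group gT}) : A \subset 'N(U) -> [acts A, on lines | 'JG].
Proof.
move=> nUA; apply/actsP=> a Aa L; rewrite p1ElemE // !inE /= cardJg.
by rewrite -{1}(normP (subsetP nUA a Aa)) conjSg.
Qed.

Let nZE : E \subset 'N(Z).
Proof. by rewrite normsI // norms_cent ?normG. Qed.

Lemma orbit_line L :
  L \in lines -> L != Z -> orbit 'JG E L = lines :\ Z.
Proof.
move=> linL neLZ; apply/eqP; rewrite eqEcard subsetD1 acts_sub_orbit ?acts_lines //.
rewrite linL /=; apply/andP; split.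
  apply: contra neLZ => /orbitP[a Ea defZ]; apply/eqP/val_inj => /=.
  by rewrite -(normsP nZE a^-1 (groupVr Ea)) -defZ /= conjsgK.
have := card_lines; rewrite (cardsD1 Z) mem_line_cent add1n => -[->].
rewrite card_orbit astab1JG prime_TIg ?oE //; first by rewrite indexg1 oE.
by apply: contra neLZ => /line_normalised_eq->.
Qed.

(* E permutes transitively the p lines of U other than Z, and Z is not fixed
   by K. *)
Lemma lines_orbit : orbit 'JG K Z = lines.
Proof.
have sOL: orbit 'JG K Z \subset lines.
  by rewrite acts_sub_orbit ?mem_line_cent ?acts_lines.
have [L OL neLZ]: exists2 L, L \in orbit 'JG K Z & L != Z.
  apply/exists_inP; apply: contraR ntK => /exists_inPn Oz.
  rewrite -KE_K comm_chain_trivial //; apply/normsP=> k Kk.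
  have /Oz/negPn/eqP/(congr1 val) : ('JG%act Z k) \in orbit 'JG K Z.
    exact: mem_orbit.
  by [].
have sEO: [acts E, on orbit 'JG K Z | 'JG].
  apply/subsetP=> a Ea; rewrite !inE; apply/subsetP=> _ /orbitP[k Kk <-].
  rewrite inE; apply/orbitP; exists (k ^ a); first by rewrite memJ_norm ?(subsetP nKE).
  apply: val_inj; rewrite /= -{1}(normsP nZE a Ea) -!conjsgM.
  by rewrite conjgE !mulgA mulgV mul1g.
apply/eqP; rewrite eqEsubset sOL -(setD1K mem_line_cent) subUset sub1set orbit_refl.
by rewrite -(orbit_line (subsetP sOL _ OL) neLZ) acts_sub_orbit.
Qed.

Lemma plane_irreducible (W : {group gT}) :
  W \subset U -> K \subset 'N(W) -> W :!=: 1 -> W :=: U.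
Proof.
move=> sWU nWK ntW; have [_ _ [b oW]] := pgroup_pdiv (pgroupS sWU pU) ntW.
apply/eqP; rewrite eqEcard sWU oU oW leq_exp2l ?(prime_gt1 p_pr) //.
case: b oW => [oW|//]; have WL: W \in lines by rewrite p1ElemE // !inE sWU oW /=.
have /orbit_eqP eqO : W \in orbit 'JG K Z by rewrite lines_orbit.
move: (congr1 (fun S : {set {group gT}} => #|S|) eqO).
rewrite lines_orbit card_lines card_orbit astab1JG (setIidPl nWK) indexgg.
by case: p p_pr.
Qed.

Lemma norm_line_cent : 'N_K(Z) = 'C_K(E).
Proof.
apply/eqP; rewrite eqEsubset; apply/andP; split; rewrite subsetI subsetIl /=.
  apply/commG1P; apply: comm_chain_trivial; rewrite ?subsetIl ?subsetIr //.
  by rewrite normsI // (subset_trans nZE) ?normG.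
rewrite normsI ?(subset_trans (subsetIl _ _) nUK) //.
exact: subset_trans (subsetIr _ _) (normG _).
Qed.

Lemma index_plane_cent : #|K : 'C_K(E)| = p.+1.
Proof. by rewrite -norm_line_cent -astab1JG -card_orbit lines_orbit card_lines. Qed.

(** Normalisers grow in the nilpotent group K, so some g outside C normalises C. Then C fixes the
    lines Z and [Z :^ g]; as E normalises C and moves [Z :^ g] to every line other than Z, C fixes
    all lines, which makes it normal. Since E centralises C and [[~: K, E] = K], so does K. *)
Lemma plane_cent_central : 'C_K(E) \subset 'Z(K).
Proof.
set C := 'C_K(E)%G.
have nCK: K \subset 'N(C).
  have [g NCg notCg]: exists2 g, g \in 'N_K(C) & g \notin C.
    apply/subsetPn; apply: contra ntK => sNC.
    have eqKC := nilpotent_sub_norm nilK (subsetIl _ _) sNC.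
    by have := index_plane_cent; rewrite -/C -eqKC indexgg; case: p p_pr.
  have [Kg nCg] := setIP NCg.
  have linZ k : k \in K -> (Z :^ k)%G \in lines.
    by move=> Kk; have := mem_orbit 'JG%act Z Kk; rewrite lines_orbit.
  have Lg := linZ g Kg.
  have neLg: (Z :^ g)%G != Z.
    by apply: contra notCg => /eqP/congr_group/normP nZg; rewrite /C /= -norm_line_cent inE Kg.
  have nLC L: L \in lines -> C \subset 'N(L).
    have nCE: E \subset 'N(C) by rewrite cents_norm // centsC subsetIr.
    have [-> _ | neLZ linL] := eqVneq L Z; first by rewrite /C /= -norm_line_cent subsetIr.
    have: L \in orbit 'JG E (Z :^ g)%G by rewrite orbit_line // in_setD1 neLZ.
    case/orbitP=> a Ea <-; rewrite /= normJ -sub_conjgV (normsP nCE) ?groupV //.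
    rewrite normJ -sub_conjgV (normP (groupVr nCg)).
    by rewrite /C /= -norm_line_cent subsetIr.
  apply/subsetP=> k Kk; rewrite inE.
  suffices: C :^ k \subset 'N_K(Z) by rewrite norm_line_cent.
  rewrite subsetI conj_subG ?subsetIl //= sub_conjg -normJ.
  by rewrite (nLC (Z :^ k^-1)%G) ?linZ ?groupV.
rewrite subsetI subsetIl centsC /= -{1}KE_K.
apply: comm_norm_cent_cent => //.
by rewrite centsC subsetIr.
Qed.

(** A central subgroup of K has a K-invariant fixed-point group on U; if it contains Z it is all of
    U by irreducibility. Hence ['C_K(E)] embeds in the automorphism group of Z, cyclic of order p -
    1. *)
Lemma plane_cent_faithful : 'C_('C_K(E))(Z) = 1.
Proof.
set C := ('C_('C_K(E))(Z))%G; apply/trivgP.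
have cKC: C \subset 'C(K).
  apply: subset_trans (subsetIl _ _) (subset_trans plane_cent_central _).
  exact: subsetIr.
have sZC: Z \subset 'C_U(C) by rewrite subsetI sZU centsC subsetIr.
have UC: 'C_U(C) = U.
  apply: plane_irreducible (subsetIl _ _) _ _.
    by rewrite normsI // norms_cent // cents_norm // centsC.
  by apply: contraTneq sZC => ->; rewrite subG1 -cardG_gt1 card_plane_cent prime_gt1.
rewrite -faithK subsetI centsC -{1}UC subsetIr andbT.
by rewrite /C /= -setIA subsetIl.
Qed.

Lemma plane_cent_isog : 'C_K(E) \isog conj_aut Z @* 'C_K(E).
Proof.
have nZC: 'C_K(E) \subset 'N(Z) by rewrite -norm_line_cent subsetIr.
have injC: 'injm (restrm nZC (conj_aut Z)).
  by rewrite ker_restrm ker_conj_aut plane_cent_faithful.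
by have := sub_isog (subxx _) injC; rewrite morphim_restrm setIid.
Qed.

Lemma plane_cent_cyclic : cyclic 'C_K(E).
Proof.
rewrite (isog_cyclic plane_cent_isog) (cyclicS (Aut_conj_aut _ _)) //.
by rewrite Aut_prime_cyclic ?card_plane_cent.
Qed.

Lemma card_plane_cent_dvd : #|'C_K(E)| %| p.-1.
Proof.
rewrite (card_isog plane_cent_isog) -totient_prime // -card_plane_cent.
rewrite -card_Aut_cyclic ?prime_cyclic ?card_plane_cent //.
by rewrite cardSg ?Aut_conj_aut.
Qed.

(** K is transitive on the lines, so their stabilisers are conjugate to ['N_K(Z) = 'C_K(E)], and
    conjugation does not move a central subgroup. *)
Lemma norm_line_sub L : L \in lines -> 'N_K(L) \subset 'C_K(E).
Proof.
rewrite -lines_orbit => /orbitP[k Kk <-] /=.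
have nCk: k \in 'N('C_K(E)).
  apply: (subsetP _ k Kk); rewrite cents_norm // centsC.
  exact: subset_trans plane_cent_central (subsetIr _ _).
by rewrite -(normP nCk) normJ -{1}(conjGid Kk) -conjIg conjSg norm_line_cent.
Qed.

(** By coprimeness E fixes only 1 in this group of order p + 1, so it permutes the p other elements
    in one orbit. One of them is an involution since p + 1 is even, hence all are. *)
Lemma plane_quo_abelem : 2 < p -> 2.-abelem (K / 'C_K(E)).
Proof.
set C := 'C_K(E)%G => p_gt2.
have nCK: K \subset 'N(C).
  rewrite cents_norm // centsC.
  exact: subset_trans plane_cent_central (subsetIr _ _).
have nCE: E \subset 'N(C) by rewrite cents_norm // centsC subsetIr.
have oKb: #|K / C| = p.+1 by rewrite card_quotient // index_plane_cent.
have oEb: #|E / C| = p.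
  by rewrite -(card_isog (quotient_isog nCE _)) // coprime_TIg // (coprimeSg (subsetIl _ _)).
have solK := nilpotent_sol nilK.
have Cb1: 'C_(K / C)(E / C) = 1.
  by rewrite -coprime_quotient_cent ?subsetIl // trivg_quotient.
have /(@Cauchy _ 2 _ isT)[y Ky oy]: 2 %| #|K / C|.
  rewrite oKb dvdn2 /= negbK.
  by have [p2|] := even_prime p_pr; first by rewrite p2 in p_gt2.
have nty: y != 1 by rewrite -order_gt1 oy.
have eqy: y ^: (E / C) = (K / C)^#.
  apply/eqP; rewrite eqEcard; apply/andP; split.
    apply/subsetP=> _ /imsetP[a Ea ->]; rewrite !inE conjg_eq1 nty memJ_norm //.
    exact: subsetP (quotient_norms _ nKE) _ Ea.
  have := oKb; rewrite (cardsD1 1) group1 add1n => -[->].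
  rewrite -index_cent1 prime_TIg ?oEb //; first by rewrite indexg1 oEb.
  apply: contra nty => cyE; have: y \in 'C_(K / C)(E / C) by rewrite inE Ky -sub_cent1.
  by rewrite Cb1 => /set1P->.
apply: exponent2_abelem; apply/exponentP=> x Kx.
have [-> | ntx] := eqVneq x 1; first exact: expg1n.
have: x \in y ^: (E / C) by rewrite eqy !inE ntx.
by case/imsetP=> a _ ->; rewrite -conjXg -oy expg_order conj1g.
Qed.

(* Put C = 'C_K(E), cyclic and central, with K / C an elementary abelian 2-group
   of order p + 1.  For y in K outside C, the commutators [~ y, k] have square 1
   in C, so #|K : 'C_K[y]| <= 2; an abelian subgroup containing C and y acts
   irreducibly on U, so is cyclic and has order 2 modulo C, whence
   #|'C_K[y] : C| = 2 and p + 1 <= 4. *)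
Lemma plane_prime : 2 < p -> [/\ p = 3, 2.-group K & ~~ abelian K].
Proof.
set C := 'C_K(E)%G => p_gt2; have abelKb := plane_quo_abelem p_gt2.
have sCK: C \subset K := subsetIl _ _.
have cKC: C \subset 'C(K) := subset_trans plane_cent_central (subsetIr _ _).
have nCK: K \subset 'N(C) by rewrite cents_norm // centsC.
have [y Ky notCy]: exists2 y, y \in K & y \notin C.
  apply/subsetPn; apply/negP=> sKC.
  have := index_plane_cent; rewrite (_ : 'C_K(E) = K) ?indexgg; first by case: p p_pr.
  by apply/eqP; rewrite eqEsubset sKC sCK.
have quo2 x : x \in K -> x ^+ 2 \in C.
  move=> Kx; apply: coset_idr; first by rewrite groupX ?(subsetP nCK).
  have [_ /(_ (coset C x))] := abelemP (isT : prime 2) abelKb.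
  by rewrite morphX ?(subsetP nCK) //; apply; rewrite mem_quotient.
have sK'C: [~: K, K] \subset C.
  by rewrite -quotient_cents2 //; apply: abelem_abelian abelKb.
pose S := [set c in C | c ^+ 2 == 1].
have cardS: #|S| <= 2.
  rewrite (cardsD1 1) -add1n leq_add ?leq_b1 //; apply/card_le1_eqP=> a b.
  case/setD1P=> nta /setIdP[Ca /eqP a2] /setD1P[ntb /setIdP[Cb /eqP b2]].
  have [oa ob] := (nt_prime_order (isT : prime 2) a2 nta, nt_prime_order (isT : prime 2) b2 ntb).
  have: b \in <[a]>.
    suffices /eqP->: <[a]> :==: <[b]> by rewrite cycle_id.
    by rewrite (eq_subG_cyclic plane_cent_cyclic) ?cycle_subG // -!orderE oa ob.
  by rewrite cycle2g // !inE (negPf ntb) => /eqP.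
have iCy: #|K : 'C_K[y]| <= 2.
  rewrite index_cent1; apply: leq_trans cardS.
  rewrite -(card_lcoset S y); apply: subset_leq_card.
  apply/subsetP=> _ /imsetP[k Kk ->]; rewrite mem_lcoset conjg_mulR mulKg.
  have Cyk: [~ y, k] \in C by rewrite (subsetP sK'C) ?mem_commg.
  have cCyk x : x \in K -> commute x [~ y, k].
    by move=> Kx; apply: commute_sym; apply: (centP (subsetP cKC _ Cyk)).
  rewrite inE Cyk -commXg; last exact: cCyk.
  by apply/commgP; apply: (centP (subsetP cKC _ (quo2 y Ky))).
pose M := (<[y]> <*> C)%G.
have sCM: C \subset M := joing_subr _ _.
have My: y \in M by rewrite (subsetP (joing_subl _ _)) ?cycle_id.
have small (A : {group gT}) :
  A \subset K -> abelian A -> M \subset A -> #|A : C| = 2.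
  move=> sAK cAA sMA.
  (* An invariant line would have y in its stabiliser, and all line stabilisers in K lie in C. *)
  have minU: minnormal U A.
    apply/mingroupP; split=> [|H /andP[ntH nHA] sHU].
      by rewrite (subset_trans sAK nUK) -cardG_gt1 oU (ltn_exp2l 0) ?prime_gt1.
    have [_ _ [b oH]] := pgroup_pdiv (pgroupS sHU pU) ntH.
    apply/eqP; rewrite eqEcard sHU oU oH leq_exp2l ?(prime_gt1 p_pr) //.
    case: b oH => [oH|//]; case/negP: notCy; apply: (subsetP (@norm_line_sub H _)).
      by rewrite p1ElemE // !inE sHU oH /=.
    by rewrite inE Ky (subsetP nHA) ?(subsetP sMA).
  have cycA: cyclic A.
    have := minnormal_abelian_quo_cyclic abelU cAA minU.
    rewrite (_ : 'C_A(U) = 1); first by rewrite -(isog_cyclic (quotient1_isog _)).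
    by apply/trivgP; rewrite -faithK setSI.
  have nCA := subset_trans sAK nCK.
  rewrite -card_quotient //; apply: cyclic_abelem_prime.
  - exact: abelemS (quotientS _ sAK) abelKb.
  - exact: quotient_cyclic.
  rewrite -subG1 quotient_sub1 //; apply: contra notCy => sAC.
  by rewrite (subsetP (subset_trans sMA sAC)).
have sMK: M \subset K by rewrite join_subG cycle_subG Ky.
have cMM: abelian M.
  rewrite abelianY cycle_abelian cyclic_abelian ?plane_cent_cyclic //=.
  by rewrite cent_cycle sub_cent1 (subsetP (_ : K \subset 'C(C))) // centsC.
(* If k commutes with y, adjoining k to M keeps it abelian, so the larger group still has index 2
   over C and equals M. *)
have sCyM: 'C_K[y] \subset M.
  apply/subsetP=> k /setIP[Kk cyk].
  pose A := (<[k]> <*> M)%G.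
  have sAK: A \subset K by rewrite join_subG cycle_subG Kk.
  have cAA: abelian A.
    rewrite abelianY cycle_abelian cMM /= cent_cycle join_subG cycle_subG.
    by rewrite cent1C cyk sub_cent1 (subsetP (_ : K \subset 'C(C))) // centsC.
  have sMA: M \subset A := joing_subr _ _.
  have iA := small A sAK cAA sMA.
  have iM := small M sMK cMM (subxx _).
  have eqAM: M :=: A.
    apply/eqP; rewrite eqEcard sMA -(Lagrange sCM) -(Lagrange (subset_trans sCM sMA)).
    by rewrite iA iM leqnn.
  by rewrite eqAM (subsetP (joing_subl _ _)) ?cycle_id.
have sCCy: C \subset 'C_K[y].
  by rewrite subsetI sCK sub_cent1 (subsetP (_ : K \subset 'C(C))) // centsC.
have iC: #|K : C| = p.+1 := index_plane_cent.
have p3: p = 3.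
  apply/eqP; rewrite eqn_leq p_gt2 andbT -ltnS -iC.
  rewrite -(Lagrange_index (subsetIl _ _) sCCy) (@leq_trans (2 * 2)) // leq_mul //.
  rewrite -(small M sMK cMM (subxx _)) -(leq_pmul2l (cardG_gt0 C)).
  by rewrite !Lagrange // subset_leq_card.
split=> //.
  rewrite /pgroup -(Lagrange sCK) iC p3 pnatM andbT.
  by rewrite (pnat_dvd card_plane_cent_dvd) // p3.
apply/negP=> /(small K (subxx _)) /(_ sMK); by rewrite iC p3.
Qed.

End PlaneAction.

Lemma plane_action (gT : finGroupType) p (U K E : {group gT}) :
    prime p -> p.-abelem U -> #|U| = (p ^ 2)%N ->
    K \subset 'N(U) -> p^'.-group K -> 'C_K(U) = 1 -> nilpotent K -> K :!=: 1 ->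
    #|E| = p -> E \subset 'N(U) -> E \subset 'N(K) -> [~: K, E] = K ->
  [/\ forall W : {group gT}, W \subset U -> K \subset 'N(W) -> W :!=: 1 -> W :=: U,
      #|K : 'C_K(E)| = p.+1
    & p = 2 /\ #|K| = 3 \/ [/\ p = 3, 2.-group K & ~~ abelian K]].
Proof.
move=> p_pr abelU oU nUK p'K faithK nilK ntK oE nUE nKE KE_K.
split=> [W sWU nWK ntW||].
- exact: (plane_irreducible p_pr abelU oU nUK p'K faithK ntK oE nUE nKE KE_K).
- exact: (index_plane_cent p_pr abelU oU nUK p'K faithK ntK oE nUE nKE KE_K).
have [p2 | odd_p] := even_prime p_pr; [left | right].
  rewrite -(Lagrange (subsetIl K 'C(E))).
  rewrite (index_plane_cent p_pr abelU oU nUK p'K faithK ntK oE nUE nKE KE_K).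
  (* For p = 2 the order of ['C_K(E)] divides p - 1 = 1, which leaves [#|K| = 3]. *)
  have := card_plane_cent_dvd p_pr abelU oU nUK p'K faithK nilK ntK oE nUE nKE KE_K.
  by rewrite p2 dvdn1 => /eqP->.
apply: (plane_prime p_pr abelU oU nUK p'K faithK nilK ntK oE nUE nKE KE_K).
by rewrite ltn_neqAle prime_gt1 // andbT; apply: contraTneq odd_p => <-.
Qed.
Lemma comm_join_mod (gT : finGroupType) (V U A B : {group gT}) :
    U \subset V -> V \subset 'N(U) -> A \subset 'N(V) -> B \subset 'N(V) ->
    [~: V, A] \subset U -> [~: V, B] \subset U ->
  A <*> B \subset 'N(U) /\ [~: V, A <*> B] \subset U.
Proof.
move=> sUV nUV nVA nVB sA sB.
have nU (C : {group gT}) : C \subset 'N(V) -> [~: V, C] \subset U -> C \subset 'N(U).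
  by move=> nVC sC; rewrite -commg_subl (subset_trans (commSg _ sUV)).
have nUA := nU A nVA sA; have nUB := nU B nVB sB.
have nUAB: A <*> B \subset 'N(U) by rewrite join_subG nUA.
split=> //; rewrite commGC -quotient_cents2 // quotientY // join_subG.
by rewrite !quotient_cents2 // ![[~: _, V]]commGC sA.
Qed.

Lemma der1_cent_cyclic (gT : finGroupType) (A L : {group gT}) :
  cyclic L -> A \subset 'N(L) -> [~: A, A] \subset 'C(L).
Proof.
move=> cycL nLA; rewrite -ker_conj_aut -sub_morphim_pre ?comm_subG //.
rewrite morphimR //; apply/trivgP/commG1P.
exact: sub_abelian_cent2 (Aut_cyclic_abelian cycL) (Aut_conj_aut _ _) (Aut_conj_aut _ _).
Qed.

(** * Transvections normalising a nilpotent p'-group *)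

Section TransvectionAction.

Variables (gT : finGroupType) (p : nat) (V Y E : {group gT}).
Hypotheses (p_pr : prime p) (abelV : p.-abelem V).
Hypotheses (nVY : Y \subset 'N(V)) (p'Y : p^'.-group Y) (faithY : 'C_Y(V) = 1).
Hypothesis (nilY : nilpotent Y).
Hypotheses (oE : #|E| = p) (nVE : E \subset 'N(V)) (nYE : E \subset 'N(Y)).
Hypotheses (oVE : #|[~: V, E]| = p).

Local Notation Z := [~: V, E]%G.

Let pV : p.-group V := abelem_pgroup abelV.
Let pE : p.-group E. Proof. by rewrite /pgroup oE pnat_id. Qed.
Let cVV : abelian V := abelem_abelian abelV.
Let sZV : Z \subset V. Proof. by rewrite commg_subl. Qed.

Let nsub (U : {group gT}) : U \subset V -> V \subset 'N(U).
Proof. by move=> sUV; rewrite sub_abelian_norm. Qed.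

Let coVY : coprime #|V| #|Y|. Proof. exact: pnat_coprime pV p'Y. Qed.

Let coYE : coprime #|Y| #|E|.
Proof. by rewrite coprime_sym (pnat_coprime pE). Qed.

Let cZE : E \subset 'C(Z).
Proof.
have nZE: E \subset 'N(Z) by apply: commg_normr.
have ntZ: Z :!=: 1 by rewrite -cardG_gt1 oVE prime_gt1.
have pZ := pgroupS sZV pV.
have ntC := pgroup_cent_neq1 pE pZ nZE ntZ.
have [_ _ [b oC]] := pgroup_pdiv (pgroupS (subsetIl _ _) pZ) ntC.
suffices <-: 'C_Z(E) = Z by rewrite centsC subsetIr.
apply/eqP; rewrite eqEcard subsetIl oVE oC.
by rewrite expnS leq_pmulr ?expn_gt0 ?prime_gt0.
Qed.

Lemma faithful_mod (A U : {group gT}) :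
  A \subset Y -> U \subset V -> [~: V, A] \subset U -> 'C_A(U) = 1.
Proof.
move=> sAY sUV sVAU; apply/trivgP; rewrite -faithY.
have sCA: 'C_A(U) \subset A := subsetIl _ _.
have sCY := subset_trans sCA sAY.
rewrite subsetI sCY /=; apply: (@coprime_stab_chain _ _ V U).
- exact: subset_trans sCY nVY.
- exact: coprimegS sCY coVY.
- exact: abelian_sol.
- exact: subset_trans (commgS _ sCA) sVAU.
exact: subsetIr.
Qed.

(** E centralises Z and A normalises it, so [[~: A, E] = A] centralises Z as well as V / Z;
    coprimeness and faithfulness finish. *)
Lemma line_not_stab (A : {group gT}) :
    A \subset Y -> E \subset 'N(A) -> [~: A, E] = A -> [~: V, A] \subset Z ->
  A :=: 1.
Proof.
move=> sAY nAE AE_A sVAZ.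
have nZA: A \subset 'N(Z) by rewrite -commg_subl (subset_trans (commSg _ sZV)).
rewrite -(faithful_mod sAY sZV sVAZ); apply/esym/setIidPl.
by rewrite -AE_A; apply: comm_norm_cent_cent.
Qed.

Definition plane_of y := (Z <*> (Z :^ y))%G.
(** E and its conjugate by y both act trivially on V modulo [plane_of y]. The outer commutator with
    E secures [[~: plane_grp y, E] = plane_grp y], a hypothesis of [plane_action]. *)
Definition plane_grp y := [~: (E <*> (E :^ y)) :&: Y, E]%G.

Section OneElement.

Variable y : gT.
Hypotheses (Yy : y \in Y) (notCy : y \notin 'C(E)).

Let Vy : V :^ y = V. Proof. exact: normsP nVY y Yy. Qed.

Lemma sub_plane_of : Z \subset plane_of y. Proof. exact: joing_subl. Qed.

Lemma plane_of_sub : plane_of y \subset V.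
Proof. by rewrite join_subG sZV /= -{2}Vy conjSg. Qed.

Let Ey := (E :^ y)%G.

Let nVEy : Ey \subset 'N(V). Proof. by rewrite /= -Vy normJ conjSg. Qed.

Lemma plane_of_stab :
  E <*> Ey \subset 'N(plane_of y) /\ [~: V, E <*> Ey] \subset plane_of y.
Proof.
apply: comm_join_mod => //; rewrite ?nsub ?plane_of_sub ?joing_subl //=.
by rewrite -{1}Vy -conjsRg joing_subr.
Qed.

Let Yo := ((E <*> Ey) :&: Y)%G.

Let nYoE : E \subset 'N(Yo).
Proof. by rewrite normsI // (subset_trans (joing_subl E Ey)) ?normG. Qed.

Let sYoY : Yo \subset Y := subsetIr _ _.

Lemma plane_grp_sub : plane_grp y \subset Y.
Proof. by apply: subset_trans sYoY; rewrite commg_subl. Qed.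

Lemma plane_grp_norm : E \subset 'N(plane_grp y).
Proof. exact: commg_normr. Qed.

Lemma plane_grp_comm : [~: plane_grp y, E] = plane_grp y.
Proof.
apply: coprime_commGid => //; first exact: coprimeSg sYoY coYE.
exact: solvableS sYoY (nilpotent_sol nilY).
Qed.

Lemma comm_plane_grp : [~: V, plane_grp y] \subset plane_of y.
Proof.
have [_] := plane_of_stab; apply: subset_trans; apply: commgS.
by apply: subset_trans (subsetIl _ Y); rewrite commg_subl.
Qed.

(** Otherwise [a = [~ t, y]] commutes with t for each t in E. Then [t ^ y = t * a] and [t ^+ p = 1]
    give [a ^+ p = 1]; but a lies in the p'-group Y, so a = 1 and y centralises E. *)
Lemma plane_grp_neq1 : plane_grp y :!=: 1.
Proof.
apply: contra notCy => /eqP/commG1P cYoE.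
rewrite -sub_cent1 -cent_set1 centsC sub1set; apply/centP=> t Et.
pose a := [~ t, y]; have Yoa: a \in Yo.
  rewrite inE (_ : a \in E <*> Ey); last first.
    rewrite /a commgEl groupM //; first by rewrite groupV mem_gen // inE Et.
    by rewrite mem_gen // inE memJ_conjg Et orbT.
  by rewrite /a commgEr groupM // memJ_norm ?groupV // (subsetP nYE).
have cta: commute t a := commute_sym (centP (subsetP cYoE a Yoa) t Et).
have tp: t ^+ p = 1 by apply/eqP; rewrite -order_dvdn -oE order_dvdG.
have ap: a ^+ p = 1.
  have: (t * a) ^+ p = 1 by rewrite -conjg_mulR -conjXg tp conj1g.
  by rewrite expgMn // tp mul1g.
suffices /commgP : a == 1 by move/commute_sym.
rewrite -order_eq1 -dvdn1.
have /eqnP <- : coprime #|Y| #|E| := coYE.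
by rewrite dvdn_gcd order_dvdG ?(subsetP sYoY) // oE order_dvdn ap /=.
Qed.

(** Order p would mean [plane_of y = Z], and then [line_not_stab] would kill [plane_grp y]. *)
Lemma card_plane_of : #|plane_of y| = (p ^ 2)%N.
Proof.
have ntP: plane_of y :!=: 1.
  apply: contraTneq sub_plane_of => ->.
  by rewrite subG1 -cardG_gt1 oVE prime_gt1.
have [_ _ [b oP]] := pgroup_pdiv (pgroupS plane_of_sub pV) ntP.
have leP: #|plane_of y| <= p ^ 2.
  have sZyV: Z :^ y \subset V by rewrite -{2}Vy conjSg.
  rewrite /= cent_joinEr; last exact: sub_abelian_cent2 cVV sZyV sZV.
  have <-: (#|(Z * Z :^ y)%g| * #|Z :&: Z :^ y|)%N = (p ^ 2)%N.
    by rewrite -mul_cardG cardJg oVE.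
  by rewrite leq_pmulr ?cardG_gt0.
rewrite oP leq_exp2l ?(prime_gt1 p_pr) // in leP; rewrite oP.
case: b leP oP => [_ oP | [|//] //]; case/negP: plane_grp_neq1.
have eqPZ: plane_of y :=: Z.
  by apply/esym/eqP; rewrite eqEcard sub_plane_of oP oVE /=.
apply/eqP/line_not_stab; rewrite ?plane_grp_sub ?plane_grp_norm ?plane_grp_comm //.
by rewrite -eqPZ comm_plane_grp.
Qed.

End OneElement.

Lemma sub_plane_action (A U : {group gT}) :
    A \subset Y -> U \subset V -> #|U| = (p ^ 2)%N -> [~: V, A] \subset U ->
    E \subset 'N(U) -> E \subset 'N(A) -> [~: A, E] = A -> A :!=: 1 ->
  [/\ forall W : {group gT}, W \subset U -> A \subset 'N(W) -> W :!=: 1 -> W :=: U,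
      #|A : 'C_A(E)| = p.+1
    & p = 2 /\ #|A| = 3 \/ [/\ p = 3, 2.-group A & ~~ abelian A]].
Proof.
move=> sAY sUV oU sVAU nUE nAE AE_A ntA.
apply: plane_action => //.
- exact: abelemS sUV abelV.
- by rewrite -commg_subl (subset_trans (commSg _ sUV)).
- exact: pgroupS sAY p'Y.
- exact: faithful_mod.
exact: nilpotentS sAY nilY.
Qed.

Lemma plane_of_action y : y \in Y -> y \notin 'C(E) ->
  [/\ forall W : {group gT}, W \subset plane_of y -> plane_grp y \subset 'N(W) ->
        W :!=: 1 -> W :=: plane_of y,
      #|plane_grp y : 'C_(plane_grp y)(E)| = p.+1
    & p = 2 /\ #|plane_grp y| = 3
      \/ [/\ p = 3, 2.-group (plane_grp y) & ~~ abelian (plane_grp y)]].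
Proof.
move=> Yy notCy; have [nPE sVP] := plane_of_stab Yy.
apply: sub_plane_action.
- exact: plane_grp_sub.
- exact: plane_of_sub.
- exact: card_plane_of.
- exact: comm_plane_grp.
- exact: subset_trans (joing_subl _ _) nPE.
- exact: plane_grp_norm.
- exact: plane_grp_comm.
exact: plane_grp_neq1.
Qed.

(* Two distinct planes would span an irreducible U of order p ^ 3, but the number
   1 + p + p ^ 2 of its lines is 1 modulo the prime dividing p + 1, so that one
   line is fixed. *)
Lemma plane_of_const y1 y2 :
    y1 \in Y -> y1 \notin 'C(E) -> y2 \in Y -> y2 \notin 'C(E) ->
  plane_of y1 = plane_of y2.
Proof.
move=> Yy1 nC1 Yy2 nC2; apply/eqP/idPn => neU.
have [irr1 _ st1] := plane_of_action Yy1 nC1.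
have [irr2 _ st2] := plane_of_action Yy2 nC2.
set U1 := plane_of y1 in neU irr1 *; set U2 := plane_of y2 in neU irr2 *.
set Y1 := plane_grp y1 in irr1 st1; set Y2 := plane_grp y2 in irr2 st2.
have sU1: U1 \subset V := plane_of_sub Yy1.
have sU2: U2 \subset V := plane_of_sub Yy2.
have sY1: Y1 \subset Y := plane_grp_sub y1.
have sY2: Y2 \subset Y := plane_grp_sub y2.
have oU1: #|U1| = (p ^ 2)%N := card_plane_of Yy1 nC1.
have oU2: #|U2| = (p ^ 2)%N := card_plane_of Yy2 nC2.
have [nU1 _] := plane_of_stab Yy1; have [nU2 _] := plane_of_stab Yy2.
have{nU1} nU1E: E \subset 'N(U1) := subset_trans (joing_subl _ _) nU1.
have{nU2} nU2E: E \subset 'N(U2) := subset_trans (joing_subl _ _) nU2.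
have sVY1: [~: V, Y1] \subset U1 := comm_plane_grp Yy1.
have sVY2: [~: V, Y2] \subset U2 := comm_plane_grp Yy2.
pose U := (U1 <*> U2)%G; pose A := (Y1 <*> Y2)%G.
have sUV: U \subset V by rewrite join_subG sU1.
have sAY: A \subset Y by rewrite join_subG sY1.
have sU1U: U1 \subset U := joing_subl _ _.
have sU2U: U2 \subset U := joing_subr _ _.
have sY1A: Y1 \subset A := joing_subl _ _.
have sY2A: Y2 \subset A := joing_subr _ _.
have nUE: E \subset 'N(U) by rewrite normsY.
have nAE: E \subset 'N(A) by rewrite normsY ?plane_grp_norm.
have [nUA sVA]: A \subset 'N(U) /\ [~: V, A] \subset U.
  apply: comm_join_mod; rewrite ?nsub ?(subset_trans _ nVY) //.
    exact: subset_trans sVY1 sU1U.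
  exact: subset_trans sVY2 sU2U.
have coVA: coprime #|V| #|A| := coprimegS sAY coVY.
have nVA: A \subset 'N(V) := subset_trans sAY nVY.
have eqUi (Yi : {group gT}) (Ui : {group gT}) :
    (forall W : {group gT}, W \subset Ui -> Yi \subset 'N(W) -> W :!=: 1 -> W :=: Ui) ->
    Yi \subset A -> [~: V, Yi] \subset Ui -> Yi :!=: 1 -> Ui \subset [~: V, A].
  move=> irr sYi sVYi ntYi; rewrite -(irr [~: V, Yi]%G) ?commgS //.
    exact: commg_normr.
  apply: contra ntYi => /eqP/commG1P cVYi; rewrite -subG1 -faithY subsetI.
  by rewrite (subset_trans sYi sAY) /= centsC.
have sUVA: U \subset [~: V, A].
  rewrite join_subG (eqUi Y1 U1) ?(eqUi Y2 U2) //; exact: plane_grp_neq1.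
have CUA1: 'C_U(A) = 1.
  by apply/trivgP; rewrite -(coprime_abel_cent_TI nVA coVA cVV) setSI.
have AE_A: A \subset [~: A, E].
  rewrite join_subG -{1}(plane_grp_comm y1) -{1}(plane_grp_comm y2).
  by rewrite !commSg.
(* E cannot centralise W, because [A = [~: A, E]] would too, against ['C_U(A) = 1]. So [[~: W, E]]
   is the whole of Z, W meets both planes nontrivially, and each plane is irreducible. *)
have irrU (W : {group gT}) :
    W \subset U -> A \subset 'N(W) -> E \subset 'N(W) -> W :!=: 1 -> W :=: U.
  move=> sWU nWA nWE ntW; apply/eqP; rewrite eqEsubset sWU /=.
  have sZW: Z \subset W.
    have ntR: [~: W, E] != 1.
      apply: contra ntW => /eqP/commG1P cWE; rewrite -subG1 -CUA1 subsetI sWU.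
      rewrite centsC; apply: subset_trans AE_A _.
      by apply: comm_norm_cent_cent => //; rewrite centsC.
    have sRW: [~: W, E] \subset W by rewrite commg_subl.
    apply: (subset_trans _ sRW); suffices ->: Z = [~: W, E]%G by [].
    apply/val_inj/eqP; rewrite /= eq_sym eqEcard commSg ?(subset_trans sWU) //.
    have pR := pgroupS (subset_trans sRW (subset_trans sWU sUV)) pV.
    have [_ _ [b oR]] := pgroup_pdiv pR ntR.
    by rewrite oVE oR expnS leq_pmulr ?expn_gt0 ?prime_gt0.
  have ntI y (Ui : {group gT}) : Ui = plane_of y -> W :&: Ui != 1.
    move=> ->; apply: contraTneq (prime_gt1 p_pr) => WU1.
    have: Z \subset W :&: plane_of y by rewrite subsetI sZW sub_plane_of.
    by rewrite WU1 -oVE cardG_gt1 negbK => /trivgP/eqP.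
  have nUY (Yi Ui : {group gT}) : Yi \subset Y -> Ui \subset V ->
      [~: V, Yi] \subset Ui -> Yi \subset A -> Yi \subset 'N(W :&: Ui).
    move=> sYi sUi sVi sYiA; apply: normsI; first exact: subset_trans sYiA nWA.
    by rewrite -commg_subl (subset_trans (commSg _ sUi)).
  rewrite join_subG -{1}(irr1 (W :&: U1)%G) ?subsetIr ?nUY ?(ntI y1) //.
  by rewrite subsetIl -(irr2 (W :&: U2)%G) ?subsetIr ?nUY ?(ntI y2) ?subsetIl.
have oU: #|U| = (p ^ 3)%N.
  have oI: #|U1 :&: U2| = p.
    have sZI: Z \subset U1 :&: U2 by rewrite subsetI !sub_plane_of.
    have ntI: U1 :&: U2 != 1.
      apply: contraTneq sZI => ->.
      by rewrite subG1 -cardG_gt1 oVE prime_gt1.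
    have pI: p.-group (U1 :&: U2) := pgroupS (subset_trans (subsetIl _ _) sU1) pV.
    have [_ _ [b oI]] := pgroup_pdiv pI ntI.
    have: U1 :&: U2 \proper U1.
      rewrite properE subsetIl; apply: contra neU; rewrite subsetI subxx /= => sU12.
      by apply/eqP/val_inj/eqP; rewrite eqEcard sU12 oU1 oU2 /=.
    move/proper_card; rewrite oI oU1 ltn_exp2l ?(prime_gt1 p_pr) //.
    by case: b {oI}.
  apply/eqP; rewrite -(eqn_pmul2r (prime_gt0 p_pr)) -{1}oI /= cent_joinEr.
    by rewrite -mul_cardG oU1 oU2 -expnD -expnSr.
  exact: sub_abelian_cent2 cVV sU2 sU1.
(* r is the prime dividing p + 1: 3 for p = 2 and 2 for p = 3, where U has 7 and 13 lines
   respectively. *)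
have [r [r_pr rY1 rY2 mod_r]]: exists r,
    [/\ prime r, r.-group Y1, r.-group Y2 & ((1 + p + p ^ 2) %% r = 1)%N].
  case: st1 st2 => [[p2 oY1]|[p3 rY1 _]] [[p2' oY2]|[p3' rY2 _]].
  - by exists 3; rewrite /pgroup oY1 oY2 p2.
  - by rewrite p2 in p3'.
  - by rewrite p3 in p2'.
  - by exists 2; rewrite p3.
have rA: r.-group A.
  apply: pgroupS (pcore_pgroup r Y); rewrite join_subG.
  by rewrite !(sub_normal_Hall (nilpotent_pcore_Hall r nilY)) ?pcore_normal // rY1.
have abelU: p.-abelem U := abelemS sUV abelV.
have [L linL nLA]: exists2 L : {group gT}, L \in 'E_p^1(U) & A \subset 'N(L).
  have U3: U \in 'E_p^3(U) by rewrite pnElemE // !inE subxx abelU oU /=.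
  have := pgroup_fix_mod rA (acts_lines p_pr nUA).
  rewrite (card_p1Elem_pnElem U3) !big_ord_recl big_ord0 /= addn0 expn1.
  rewrite addnA mod_r => fix1.
  have [L]: exists L, L \in 'Fix_('E_p^1(U) | 'JG)(A).
    apply/set0Pn; apply: contra_eqN (esym fix1) => /eqP->.
    by rewrite cards0 mod0n.
  case/setIP=> linL /afixP fixL; exists L => //.
  by apply/normsP=> a Aa; apply: congr_group (fixL a Aa).
move: linL; rewrite p1ElemE // !inE => /andP[sLU /eqP oL].
have cycL: cyclic L by rewrite prime_cyclic ?oL.
have ntL: L :!=: 1 by rewrite -cardG_gt1 oL prime_gt1.
(* L is only A-invariant, so [irrU] does not refute it directly. But A acts on the cyclic group L
   through an abelian group, so [[~: A, A]] centralises L; its fixed points on U are invariant under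
   A and E, hence are everything. *)
have cAA: abelian A.
  apply/commG1P; pose D := [~: A, A]%G.
  have sDA: D \subset A by rewrite commg_subl normG.
  have nDA: A \subset 'N(D) by rewrite commg_norml.
  have nDE: E \subset 'N(D) by rewrite normsR.
  have eqCU: 'C_U(D) = U.
    apply: irrU.
    - exact: subsetIl.
    - by rewrite normsI // norms_cent.
    - by rewrite normsI // norms_cent.
    apply: contra ntL => /eqP CU1; rewrite -subG1 -CU1 subsetI sLU centsC.
    exact: der1_cent_cyclic.
  have sVD: [~: V, D] \subset U := subset_trans (commgS _ sDA) sVA.
  rewrite -(faithful_mod (subset_trans sDA sAY) sUV sVD).
  by apply/esym/setIidPl; rewrite centsC -eqCU subsetIr.
(* For p = 3 the nonabelian subgroup Y1 is already a contradiction. For p = 2 the line L has order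
   2, so A centralises it, against ['C_U(A) = 1]. *)
case: st1 => [[p2 _] | [_ _ /negP[]]]; last exact: abelianS sY1A cAA.
case/negP: ntL; rewrite -subG1 -CUA1 subsetI sLU centsC.
rewrite -ker_conj_aut -sub_morphim_pre //.
rewrite (subset_trans (Aut_conj_aut _ _)) // subG1 trivg_card1.
by rewrite card_Aut_cyclic // oL p2.
Qed.

(** A generator [[~ y, e]] of K lies in the group generated by E and [E :^ y], trivial on V modulo
    [plane_of y]. As that plane does not depend on y, K is trivial on V modulo a single plane and
    [plane_action] applies to K itself. *)
Lemma transvection_structure (K := [~: Y, E]%G) (U := [~: V, K]%G) :
    ~~ (Y \subset 'C(E)) ->
  [/\ #|U| = (p ^ 2)%N, Z \subset U,
      forall W : {group gT}, W \subset U -> K \subset 'N(W) -> W :!=: 1 -> W :=: U,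
      #|K : 'C_K(E)| = p.+1 & p = 2 \/ p = 3].
Proof.
move=> nCYE; have [y0 Yy0 nCy0] := subsetPn nCYE.
pose U0 := plane_of y0.
have sU0: U0 \subset V := plane_of_sub Yy0.
have nU0V: V \subset 'N(U0) := nsub sU0.
have [nU0E0 sVE0] := plane_of_stab Yy0.
have nU0E: E \subset 'N(U0) := subset_trans (joing_subl _ _) nU0E0.
have sKpre: K \subset coset U0 @*^-1 'C(V / U0).
  rewrite gen_subG; apply/subsetP=> _ /imset2P[y e Yy Ee ->].
  have [cy | nCy] := boolP (y \in 'C(E)).
    by rewrite (_ : [~ y, e] = 1) ?group1 //; apply/eqP/commgP; apply: (centP cy).
  have [nUM sVM] := plane_of_stab Yy.
  rewrite (plane_of_const Yy nCy Yy0 nCy0) -/U0 in nUM sVM.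
  have Mye: [~ y, e] \in E <*> (E :^ y).
    rewrite commgEr groupM //; last by rewrite mem_gen // inE Ee.
    by rewrite mem_gen // inE memJ_conjg groupV Ee orbT.
  apply/morphpreP; split; first exact: subsetP nUM _ Mye.
  have: (E <*> (E :^ y)) / U0 \subset 'C(V / U0).
    by rewrite quotient_cents2 // commGC.
  by move/subsetP; apply; apply: mem_quotient.
have nU0K: K \subset 'N(U0) := subset_trans sKpre (subsetIl _ _).
have sVK: [~: V, K] \subset U0.
  rewrite commGC -quotient_cents2 //.
  by rewrite (subset_trans (quotientS _ sKpre)) // cosetpreK.
have sKY: K \subset Y by rewrite commg_subl.
have ntK: K :!=: 1 by apply: contra nCYE => /eqP/commG1P.
have KE_K: [~: K, E] = K by apply: coprime_commGid => //; apply: nilpotent_sol.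
have [irr iK pE23] := sub_plane_action sKY sU0 (card_plane_of Yy0 nCy0) sVK nU0E
  (commg_normr _ _) KE_K ntK.
have eqU: U = U0.
  apply/val_inj/irr => //=; first exact: commg_normr.
  apply: contra ntK => /eqP/commG1P cVK; rewrite -subG1 -faithY subsetI sKY.
  by rewrite centsC.
rewrite eqU (card_plane_of Yy0 nCy0) sub_plane_of; split=> //.
by case: pE23 => [[-> _] | [-> _ _]]; [left | right].
Qed.

End TransvectionAction.

(** * Pairs of transvection groups generating a p-group *)

Section CommutingTransvections.

Variables (gT : finGroupType) (p : nat) (V Y : {group gT}).
Hypotheses (p_pr : prime p) (abelV : p.-abelem V).
Hypotheses (nVY : Y \subset 'N(V)) (p'Y : p^'.-group Y) (faithY : 'C_Y(V) = 1).
Hypothesis (nilY : nilpotent Y).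

Let pV : p.-group V := abelem_pgroup abelV.
Let cVV : abelian V := abelem_abelian abelV.
Let coVY : coprime #|V| #|Y|. Proof. exact: pnat_coprime pV p'Y. Qed.

Definition transvection_group (E : {group gT}) :=
  [/\ #|E| = p, E \subset 'N(V), E \subset 'N(Y), #|[~: V, E]| = p
    & ~~ (Y \subset 'C(E))].

Local Notation K E := [~: Y, E]%G.
Local Notation U E := [~: V, K E]%G.

Section Pair.

Variables E F : {group gT}.
Hypotheses (tE : transvection_group E) (tF : transvection_group F).

(** Y normalises both planes, hence their intersection, and Y contains the groups acting irreducibly
    on each. *)
Lemma planes_TI : U E :&: U F != 1 -> U E = U F.
Proof.
have [oE nVE nYE oVE nCE] := tE; have [oF nVF nYF oVF nCF] := tF.
have [oUE sZE irrE _ _] :=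
  transvection_structure p_pr abelV nVY p'Y faithY nilY oE nVE nYE oVE nCE.
have [oUF sZF irrF _ _] :=
  transvection_structure p_pr abelV nVY p'Y faithY nilY oF nVF nYF oVF nCF.
have nUY (D : {group gT}) : D \subset 'N(Y) -> Y \subset 'N(U D).
  by move=> nYD; rewrite normsR // commg_norml.
have nIY: Y \subset 'N(U E :&: U F) by rewrite normsI ?nUY.
have sKY (D : {group gT}) : D \subset 'N(Y) -> K D \subset Y by rewrite commg_subl.
move=> ntI; apply: val_inj.
rewrite /= -(irrE (U E :&: U F)%G) ?subsetIl ?(subset_trans (sKY E nYE)) //.
by rewrite -(irrF (U E :&: U F)%G) ?subsetIr ?(subset_trans (sKY F nYF)).
Qed.

End Pair.

Lemma transvection_groupJ E x :
  x \in 'N(V) :&: 'N(Y) -> transvection_group E -> transvection_group (E :^ x)%G.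
Proof.
case/setIP=> nVx nYx [oE nVE nYE oVE nCE]; split; rewrite /= ?cardJg //.
- by rewrite -(normP nVx) normJ conjSg.
- by rewrite -(normP nYx) normJ conjSg.
- by rewrite -[V in #|[~: V, _]|](normP nVx) -conjsRg cardJg.
by rewrite -{1}(normP nYx) centJ conjSg.
Qed.

(** Conjugation by e in E carries the plane of F to the plane of [F :^ e]. The two share a fixed
    point of e, so they coincide by [planes_TI]. *)
Lemma plane_stab E F :
  transvection_group E -> transvection_group F -> E \subset 'N(U F).
Proof.
move=> tE tF; have [oE nVE nYE oVE nCE] := tE; have [oF nVF nYF oVF nCF] := tF.
have [oUF sZF irrF _ _] :=
  transvection_structure p_pr abelV nVY p'Y faithY nilY oF nVF nYF oVF nCF.
apply/normsP=> e Ee.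
have tFe: transvection_group (F :^ e)%G.
  by apply: transvection_groupJ tF; rewrite inE (subsetP nVE) ?(subsetP nYE).
have defUe: U (F :^ e)%G :=: U F :^ e.
  rewrite /= !conjsRg (normP (subsetP nYE e Ee)) (normP (subsetP nVE e Ee)).
  by [].
rewrite -defUe; apply: congr_group; apply: planes_TI => //.
have sUF: U F \subset V by rewrite commg_subl (subset_trans _ nVY) ?commg_subl.
(* The conjugates of e under the plane lie in the coset of [[~: V, E]] through e, of size p, while
   the plane has order [p ^ 2]. *)
have ntC: 'C_(U F)[e] != 1.
  apply: contraTneq (ltn_exp2l 1 2 (prime_gt1 p_pr)) => C1.
  rewrite expn1 -oUF -indexg1 -C1 index_cent1 -leqNgt -oVE.
  rewrite -(card_lcoset [~: V, E] e); apply/subset_leq_card/subsetP=> _ /imsetP[u Uu ->].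
  by rewrite mem_lcoset conjg_mulR mulKg commGC mem_commg // (subsetP sUF).
have [u /setIP[Uu ceu] ntu] := trivgPn _ ntC.
apply/trivgPn; exists u => //; rewrite inE Uu andbT [_ \in _]/=.
rewrite defUe -(memJ_conjg _ e^-1) conjsgK.
by rewrite /conjg invgK mulgA -(cent1P ceu) mulgK.
Qed.

(** If the planes meet trivially, [[~: V, E, F]] and [[~: V, F, E]] vanish and the three subgroup
    lemma applies. If they coincide, the p-group M acts on U, of order [p ^ 2], with [[~: U, M, M] =
    1], so [[~: M, M]] centralises U; M also centralises the complement ['C_V(L)], so M is abelian
    by faithfulness. *)
Lemma transvections_commute E F :
    transvection_group E -> transvection_group F -> p.-group (E <*> F) ->
    'C_(E <*> F)(V) = 1 -> F \subset 'C(E).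
Proof.
move=> tE tF pEF faithEF.
have stabU := plane_stab; move: (stabU E F tE tF) (stabU F E tF tE) => nUFE nUEF.
have [oE nVE nYE oVE nCE] := tE; have [oF nVF nYF oVF nCF] := tF.
have [oUE sZE irrE _ _] :=
  transvection_structure p_pr abelV nVY p'Y faithY nilY oE nVE nYE oVE nCE.
have [oUF sZF irrF _ _] :=
  transvection_structure p_pr abelV nVY p'Y faithY nilY oF nVF nYF oVF nCF.
have [ntI | tiUEF] := boolP (U E :&: U F != 1); last first.
  rewrite negbK in tiUEF; move/eqP: tiUEF => tiUEF.
  have cent0 (A B : {group gT}) : A \subset 'N(U B) -> [~: V, A] \subset U A ->
      [~: V, B] \subset U B -> U A :&: U B = 1 -> U B \subset V -> [~: V, B, A] = 1.
    move=> nUBA sA sB tiAB sUBV; apply/trivgP; rewrite -tiAB subsetI.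
    rewrite (subset_trans _ sA) ?commSg ?(subset_trans sB) //=.
    by rewrite (subset_trans (commSg _ sB)) // commg_subl.
  have sUV (D : {group gT}) : D \subset 'N(Y) -> U D \subset V.
    by move=> nYD; rewrite commg_subl (subset_trans _ nVY) ?commg_subl.
  have VFE := cent0 E F nUFE sZE sZF tiUEF (sUV F nYF).
  have VEF := cent0 F E nUEF sZF sZE (etrans (setIC _ _) tiUEF) (sUV E nYE).
  apply/commG1P/trivgP; rewrite -faithEF subsetI.
  rewrite comm_subG ?joing_subl ?joing_subr //=; apply/commG1P.
  by apply: three_subgroup VFE; rewrite [[~: E, V]]commGC.
have eqU := planes_TI tE tF ntI.
pose M := (E <*> F)%G; pose L := (K E <*> K F)%G.
have sKY (D : {group gT}) : D \subset 'N(Y) -> K D \subset Y by rewrite commg_subl.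
have sLY: L \subset Y by rewrite join_subG !sKY.
have sUV: U E \subset V by rewrite commg_subl (subset_trans (sKY E nYE)).
have nVL := subset_trans sLY nVY.
have coVL : coprime #|V| #|L| := coprimegS sLY coVY.
have [nUL sVL]: L \subset 'N(U E) /\ [~: V, L] \subset U E.
  apply: comm_join_mod; rewrite ?(subset_trans (sKY _ _)) //.
    by rewrite sub_abelian_norm.
  by rewrite eqU.
have eqVL: [~: V, L] = U E.
  by apply/eqP; rewrite eqEsubset sVL commgS ?joing_subl.
(* The commutator of ['C_V(K D)] with D lies in [[~: V, K D] :&: 'C_V(K D)], trivial by coprime
   action. *)
have eqC (D : {group gT}) : D \subset 'N(V) -> D \subset 'N(Y) -> [~: V, D] \subset U D ->
    K D \subset L -> U D = U E -> 'C_V(L) \subset 'C(D).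
  move=> nVD nYD sVD sKL eqUD.
  have nVK: K D \subset 'N(V) := subset_trans (sKY D nYD) nVY.
  have coVK: coprime #|V| #|K D| := coprimegS (sKY D nYD) coVY.
  apply: subset_trans (setIS V (centS sKL)) _; apply/commG1P/trivgP.
  rewrite -(coprime_abel_cent_TI nVK coVK cVV) subsetI.
  rewrite (subset_trans _ sVD) ?commSg ?subsetIl //=.
  apply: subset_trans (subsetIr V 'C(K D)); rewrite commg_subl normsI // norms_cent //.
  exact: commg_normr.
have cCE: 'C_V(L) \subset 'C(E) by apply: eqC; rewrite ?joing_subl.
have cCF: 'C_V(L) \subset 'C(F) by apply: eqC; rewrite ?joing_subr.
have cMC: M \subset 'C('C_V(L)) by rewrite join_subG centsC cCE centsC cCF.
have nUM: M \subset 'N(U E) by rewrite join_subG eqU nUFE -{1}eqU.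
have pU: p.-group (U E) := pgroupS sUV pV.
have nilUM: nilpotent (U E <*> M).
  by rewrite (pgroup_nil (_ : p.-group _)) //= (norm_joinEr nUM) pgroupM pU.
have ltR (R : {group gT}) : R \subset U E -> M \subset 'N(R) -> R :!=: 1 ->
    [~: R, M] \proper R.
  move=> sRU nRM ntR; apply: nil_comm_properl nilUM _ ntR _.
    exact: subset_trans sRU (joing_subl _ _).
  by rewrite subsetI joing_subr.
have UMM: [~: U E, M, M] = 1.
  apply/eqP/idPn => ntRM; pose R := [~: U E, M]%G.
  have sRU: R \subset U E by rewrite commg_subl.
  have nRM: M \subset 'N(R) by apply: commg_normr.
  have ntU: U E :!=: 1 by rewrite -cardG_gt1 oUE (ltn_exp2l 0) ?prime_gt1.
  have ntR: R :!=: 1 by apply: contra ntRM => /eqP/= ->; rewrite comm1G.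
  have [_ _ [b oRM]] := pgroup_pdiv (pgroupS (subset_trans (proper_sub (ltR R sRU nRM ntR)) sRU) pU) ntRM.
  have [_ _ [c oR]] := pgroup_pdiv (pgroupS sRU pU) ntR.
  have := proper_card (ltR R sRU nRM ntR).
  have := proper_card (ltR (U E) (subxx _) nUM ntU).
  rewrite oUE oRM oR !ltn_exp2l ?(prime_gt1 p_pr) //.
  by case: c {oR} => // c; case: b {oRM} => //.
have cMM: abelian M.
  apply/commG1P/trivgP; rewrite -faithEF subsetI commg_subl normG /= centsC.
  rewrite -(coprime_cent_prod nVL coVL (abelian_sol cVV)) eqVL.
  rewrite mul_subG //; last first.
    by rewrite centsC; apply: subset_trans cMC; apply: comm_subG.
  rewrite centsC; apply/commG1P.
  apply: (three_subgroup _ UMM).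
  by rewrite [[~: M, U E]]commGC.
exact: sub_abelian_cent2 cMM (joing_subr _ _) (joing_subl _ _).
Qed.

End CommutingTransvections.

(** * Direct products of copies of Sym(3) and Alt(4) *)

Lemma faithful_action_embedding (aT : finGroupType) (sT : finType)
    (to : {action aT &-> sT}) (G : {group aT}) (S : {set sT}) (n : nat) :
    #|S| = n -> [acts G, on S | to] -> 'C_G(S | to) = 1 ->
  exists f : {morphism G >-> {perm 'I_n}}, 'injm f.
Proof.
move=> oS; case: n / oS => nSG faithG.
have actS g x : g \in G -> x \in S -> to x g \in S.
  by move=> Gg Sx; rewrite (acts_act nSG).
pose ok g (s : {perm 'I_#|S|}) := [forall i, enum_val (s i) == to (enum_val i) g].
(* The default is never taken for g in G, since such a g permutes S. *)
pose f g : {perm 'I_#|S|} := odflt 1 [pick s | ok g s].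
have fE g i : g \in G -> enum_val (f g i) = to (enum_val i) g.
  move=> Gg; rewrite /f; case: pickP => [s oks | no_s] /=.
    by apply/eqP; move/forallP: oks.
  have Sg (j : 'I_#|S|) : to (enum_val j) g \in S by exact: (actS _ _ Gg (enum_valP j)).
  pose h j := enum_rank_in (Sg j) (to (enum_val j) g).
  have hE j : enum_val (h j) = to (enum_val j) g by rewrite enum_rankK_in.
  have injh : injective h.
    by move=> j k /(congr1 enum_val); rewrite !hE => /act_inj/enum_val_inj.
  by case/negP: (negbT (no_s (perm injh))); apply/forallP=> j; rewrite permE hE.
have fM : {in G &, {morph f : x y / x * y}}.
  move=> x y Gx Gy; apply/permP=> i; apply: enum_val_inj.
  by rewrite permM !fE ?groupM // actM.
exists (Morphism fM); apply/subsetP=> g; rewrite !inE => /andP[Gg /eqP fg1].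
suffices: g \in 'C_G(S | to) by rewrite faithG => /set1P->.
rewrite !inE Gg; apply/subsetP=> x Sx; rewrite inE.
have := fE g (enum_rank_in Sx x) Gg; rewrite /= in fg1.
by rewrite fg1 perm1 enum_rankK_in // => /esym/eqP.
Qed.

Section SmallFrobenius.

Variables (gT : finGroupType) (p : nat) (R E : {group gT}).
Hypotheses (p_pr : prime p) (oR : #|R| = p.+1) (oE : #|E| = p).
Hypotheses (nRE : E \subset 'N(R)) (RE_R : [~: R, E] = R) (cRR : abelian R).

Local Notation T := (R <*> E)%G.

Let coRE : coprime #|R| #|E|.
Proof. by rewrite oR oE coprimeSn. Qed.

Let tiRE : R :&: E = 1. Proof. exact: coprime_TIg. Qed.

Let oT : #|T| = (p.+1 * p)%N.
Proof. by rewrite /= norm_joinEr // TI_cardMg // oR oE. Qed.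

Lemma small_frobenius_cent : 'C_R(E) = 1.
Proof. by rewrite -{1}RE_R coprime_abel_cent_TI. Qed.

Lemma not_centRE : ~~ (E \subset 'C(R)).
Proof.
apply/negP; rewrite centsC => /commG1P; rewrite RE_R => R1.
by have := oR; rewrite R1 cards1; case: p p_pr.
Qed.

(** The centre meets R in ['C_R(E) = 1], so its order divides p. Order p would give T = R Z(T),
    making E centralise the abelian group R. *)
Lemma small_frobenius_center : 'Z(T) = 1.
Proof.
have sRT: R \subset T := joing_subl _ _.
have sET: E \subset T := joing_subr _ _.
have tiZR: R :&: 'Z(T) = 1.
  apply/trivgP; rewrite -small_frobenius_cent setIS // subIset // orbC.
  by rewrite centS.
have sZT: 'Z(T) \subset T := subsetIl _ _.
have cZR: R \subset 'C('Z(T)).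
  by rewrite centsC (subset_trans (subsetIr _ _)) // centS.
have oZ: (p.+1 * #|'Z(T)|)%N = #|R <*> 'Z(T)|.
  by rewrite cent_joinEr 1?centsC // TI_cardMg // oR.
have dvZp: #|'Z(T)| %| p.
  by rewrite -(@dvdn_pmul2l p.+1) // oZ -oT cardSg // join_subG sRT sZT.
have [_ /(_ _ dvZp)/pred2P[/card1_trivg //| oZp]] := primeP p_pr.
case/negP: not_centRE; apply: subset_trans sET _.
have /eqP <-: R <*> 'Z(T) == T by rewrite eqEcard join_subG sRT sZT -oZ oZp oT /=.
by rewrite join_subG (cRR : R \subset 'C(R)) centsC.
Qed.

(** T acts on the p + 1 cosets of E. The core of E commutes with R because [R :&: E = 1], and E has
    prime order without centralising R. *)
Lemma small_frobenius_embedding :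
  exists f : {morphism T >-> {perm 'I_p.+1}}, 'injm f.
Proof.
apply: (@faithful_action_embedding _ _ 'Rs%act T (rcosets E T)).
- apply/eqP; rewrite -(eqn_pmul2l (cardG_gt0 E)) [(#|E| * #|_|)%N]Lagrange ?joing_subr //.
  by rewrite oT oE mulnC.
- exact: actsRs_rcosets.
rewrite astabRs_rcosets; set D := gcore E T.
have sDE: D \subset E := gcore_sub _ _.
have nDR: R \subset 'N(D) := subset_trans (joing_subl R E) (gcore_norm E T).
have tiDR: [~: D, R] = 1.
  apply/trivgP; rewrite -tiRE subsetI commg_subr (subset_trans sDE) //=.
  by rewrite (subset_trans _ sDE) // commg_subl.
apply/trivgP; rewrite -(prime_TIg _ not_centRE) ?oE //.
rewrite subsetI !(subset_trans (subsetIr _ _)) //.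
exact/commG1P.
Qed.

Lemma small_frobenius_isog :
  [/\ p = 2 -> T \isog 'Sym_('I_3) & p = 3 -> T \isog 'Alt_('I_4)].
Proof.
have [f injf] := small_frobenius_embedding.
have isoT := sub_isog (subxx T) injf.
split=> p_eq; apply: isog_trans isoT _; move: f injf; rewrite p_eq => f injf.
  suffices eqT: f @* T = 'Sym_('I_3) by rewrite -[X in _ \isog X]eqT isog_refl.
  by apply/eqP; rewrite eqEcard subsetT card_Sym card_ord card_injm // oT p_eq.
suffices eqT: f @* T = 'Alt_('I_4) by rewrite -[X in _ \isog X]eqT isog_refl.
apply/eqP; rewrite eqEcard; apply/andP; split; last first.
  by rewrite card_injm // oT p_eq -(leq_pmul2l (isT : 0 < 2)) card_Alt ?card_ord.
(* The image is even on both factors: R is a commutator group, and elements of E have cube 1. *)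
rewrite morphimY ?joing_subl ?joing_subr // join_subG; apply/andP; split.
  suffices: f @* [~: R, E] \subset 'Alt_('I_4) by rewrite RE_R.
  rewrite morphimR ?joing_subl ?joing_subr // gen_subG.
  apply/subsetP=> _ /imset2P[a b _ _ ->].
  by rewrite Alt_even commgEl odd_permM odd_permV odd_permJ addbb.
apply/subsetP=> _ /morphimP[e Te Ee ->]; rewrite Alt_even.
have /eqP e3: e ^+ 3 == 1 by rewrite -order_dvdn -p_eq -oE order_dvdG.
have fe3: f e ^+ 3 = 1 by rewrite -morphX // e3 morph1.
have := odd_permM (f e ^+ 2) (f e); rewrite -expgSr fe3 odd_perm1.
by rewrite expgS expg1 odd_permM addbb addFb => <-.
Qed.

End SmallFrobenius.

Lemma isog_bigdprod (gT rT : finGroupType) (I : Type) (r : seq I)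
    (A : I -> {group gT}) (B : I -> {group rT}) (G : {group gT}) (H : {group rT}) :
    \big[dprod/1]_(i <- r) A i = G -> \big[dprod/1]_(i <- r) B i = H ->
    (forall i, A i \isog B i) ->
  G \isog H.
Proof.
move=> defG defH isoAB; elim: r G H defG defH => [|i r IHr] G H.
  by rewrite !big_nil => G1 H1; apply: trivial_isog.
rewrite !big_cons => defG defH.
have [[_ G1 _ defG1] _ _ _] := dprodP defG.
have [[_ H1 _ defH1] _ _ _] := dprodP defH.
rewrite defG1 in defG; rewrite defH1 in defH.
exact: isog_dprod defG defH (isoAB i) (IHr G1 H1 defG1 defH1).
Qed.

Lemma isog_direct_power (gT rT : finGroupType) (I : finType) (P : {set I})
    (A : I -> {group gT}) (G : {group gT}) (H : {group rT}) :
    \big[dprod/1]_(i in P) A i = G -> (forall i, i \in P -> A i \isog H) ->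
  G \isog direct_power #|P| H.
Proof.
rewrite big_enum_val => defG isoA.
have defH := setXn_dprod (fun _ : 'I_#|P| => H).
apply: (isog_bigdprod defG) defH _ => i.
apply: (isog_trans (isoA _ (enum_valP i))).
exact: isog_setXn.
Qed.

(** * Commuting reflections of an abelian p'-group *)

Section ReflectionFamily.

Variables (gT : finGroupType) (p : nat) (W : {group gT}) (EE : {set {group gT}}).
Hypotheses (p_pr : prime p) (p'W : p^'.-group W) (cWW : abelian W).
Hypothesis oEE : {in EE, forall E : {group gT}, #|E| = p}.
Hypothesis nWEE : {in EE, forall E : {group gT}, E \subset 'N(W)}.
Hypothesis oWEE : {in EE, forall E : {group gT}, #|[~: W, E]| = p.+1}.
Hypothesis cEE : {in EE &, forall E F : {group gT}, F \subset 'C(E)}.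
Hypothesis faithEE :
  {in EE &, forall E F : {group gT}, 'C_(E <*> F)(W) = 1}.

Local Notation R E := [~: W, E]%G.

Let coWE (E : {group gT}) : E \in EE -> coprime #|W| #|E|.
Proof.
by move=> /oEE->; rewrite coprime_sym (pnat_coprime (pnat_id p_pr)).
Qed.

Let sRW (E : {group gT}) : E \in EE -> R E \subset W.
Proof. by move=> EEE; rewrite commg_subl nWEE. Qed.

Let pE (E : {group gT}) : E \in EE -> p.-group E.
Proof. by move=> /oEE oE; rewrite /pgroup oE pnat_id. Qed.

(** E has no fixed point but 1 on X, so [#|X|] is 1 modulo p; being nontrivial, X has at least p + 1
    elements. *)
Lemma reflection_irr (E X : {group gT}) :
  E \in EE -> X \subset R E -> E \subset 'N(X) -> X :!=: 1 -> X :=: R E.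
Proof.
move=> EEE sXR nXE ntX; apply/eqP; rewrite eqEcard sXR oWEE //.
have fixX : 'C_X(E) = 1.
  apply/trivgP; rewrite -(coprime_abel_cent_TI (nWEE EEE) (coWE EEE) cWW).
  by rewrite setSI.
have nXE' : [acts E, on X | 'J] by rewrite astabsJ.
have := pgroup_fix_mod (pE EEE) nXE'; rewrite afixJ fixX cards1.
rewrite (modn_small (prime_gt1 p_pr)) => mod1.
rewrite (divn_eq #|X| p) mod1 -addn1 leq_add2r leq_pmull // divn_gt0 ?prime_gt0 //.
rewrite leqNgt; apply/negP=> ltXp; move: mod1; rewrite modn_small // => X1.
by rewrite -cardG_gt1 X1 in ntX.
Qed.

(** If [R E] and [R F] met nontrivially they would coincide. The abelian group G generated by E and
    F would then act semiregularly on the p nontrivial elements of [R E], so [#|G| <= p] and E = G =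
    F. *)
Lemma reflection_cent (E F : {group gT}) :
  E \in EE -> F \in EE -> E != F -> F \subset 'C(R E).
Proof.
move=> EEE FEE neEF; have [nWE nWF] := (nWEE EEE, nWEE FEE).
have cEF := cEE EEE FEE.
have nEF : F \subset 'N(E) by apply: cents_norm.
have nFE : E \subset 'N(F) by apply: cents_norm; rewrite centsC.
have nREF : F \subset 'N(R E) by rewrite normsR.
have nRFE : E \subset 'N(R F) by rewrite normsR.
have [I1 | ntI] := eqVneq (R E :&: R F) 1.
  rewrite centsC; apply/commG1P/trivgP; rewrite -I1 subsetI commg_subl nREF.
  by rewrite commSg ?sRW.
have nIE : E \subset 'N(R E :&: R F) by rewrite normsI ?commg_normr.
have nIF : F \subset 'N(R E :&: R F) by rewrite normsI ?commg_normr.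
have eqR : R F = R E.
  apply: val_inj; rewrite /= -(reflection_irr FEE (subsetIr (R E) (R F))) //.
  by rewrite (reflection_irr EEE (subsetIl (R E) (R F))).
case/eqP: neEF.
have cCF (D : {group gT}) : D \in EE -> R D = R E -> D \subset 'N(E) -> 'C_W(E) \subset 'C(D).
  move=> DEE eqRD nED; apply/commG1P/trivgP.
  rewrite -(coprime_abel_cent_TI nWE (coWE EEE) cWW) subsetI.
  have -> : [~: W, E] = [~: W, D] by rewrite -[RHS]/(gval (R D)) eqRD.
  rewrite commSg ?subsetIl //= (subset_trans _ (subsetIr W 'C(E))) //.
  by rewrite commg_subl normsI ?nWEE // norms_cent.
pose G := (E <*> F)%G.
have cGG : abelian G.
  rewrite abelianY [abelian E](cEE EEE EEE) [abelian F](cEE FEE FEE) /=.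
  by rewrite ?cEF // centsC.
have [w Rw ntw] : exists2 w, w \in R E & w != 1.
  by apply/trivgPn; rewrite -cardG_gt1 oWEE // ltnS prime_gt0.
have nRG : G \subset 'N(R E) by rewrite join_subG nREF commg_normr.
have sEG : E \subset G := joing_subl _ _.
have sFG : F \subset G := joing_subr _ _.
have CGw : 'C_G[w] = 1.
  apply/trivgP/subsetP=> c /setIP[Gc cwc]; rewrite -(faithEE EEE FEE) inE Gc /=.
  have cEc : E \subset 'C[c].
    by rewrite (subset_trans sEG) // sub_cent1 (subsetP cGG).
  have cRc : R E \subset 'C[c].
    suffices <- : 'C_(R E)[c] = R E by apply: subsetIr.
    apply: reflection_irr => //; first exact: subsetIl.
      rewrite normsI ?commg_normr //.
      by rewrite (subset_trans cEc) // -cent_cycle cent_sub.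
    by apply/trivgPn; exists w; rewrite // inE Rw cent1C.
  have cCc : 'C_W(E) \subset 'C[c].
    rewrite sub_cent1 (subsetP _ c Gc) // join_subG centsC subsetIr centsC.
    exact: cCF.
  rewrite -sub_cent1 -(coprime_cent_prod nWE (coWE EEE) (abelian_sol cWW)).
  by rewrite mul_subG.
have leG : #|G| <= p.
  rewrite -indexg1 -CGw index_cent1.
  have <- : #|(R E)^#| = p by apply/succn_inj; rewrite -(oWEE EEE) [in RHS](cardsD1 1) group1.
  apply/subset_leq_card/subsetP=> _ /imsetP[g Gg ->].
  by rewrite !inE conjg_eq1 ntw memJ_norm ?(subsetP nRG).
apply: val_inj; apply: (@etrans _ _ (G : {set _})); rewrite /=.
  by apply/eqP; rewrite eqEcard sEG (oEE EEE).
by apply/esym/eqP; rewrite eqEcard sFG (oEE FEE).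
Qed.

(** The factors centralise each other and have trivial centre, so a factor meets the product of the
    others trivially. *)
Lemma reflection_dprod :
  \big[dprod/1]_(E in EE) (R E <*> E)%G = (\prod_(E in EE) (R E <*> E))%G.
Proof.
apply/eqP/bigdprodYP => E EEE.
set G := (\prod_(j in EE | _) _)%G.
have cGT : G \subset 'C(R E <*> E).
  rewrite /G; apply: (big_ind (fun H : {group gT} => H \subset 'C(R E <*> E))).
  - exact: sub1G.
  - by move=> H K cH cK; rewrite join_subG cH.
  move=> F /andP[FEE neFE].
  have cR1 : F \subset 'C(R E) by rewrite reflection_cent // eq_sym.
  have cR2 : E \subset 'C(R F) by rewrite reflection_cent.
  have cRR : R F \subset 'C(R E) := sub_abelian_cent2 cWW (sRW FEE) (sRW EEE).
  by rewrite centY !join_subG !subsetI cRR cR1 (centsC (R F)) cR2 cEE.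
rewrite subsetD cGT /= -setI_eq0 -subset0; apply/subsetP=> x /setIP[Gx].
case/setD1P=> ntx Tx; case/eqP: ntx; apply/set1gP.
have ZT1 : 'Z(R E <*> E) = 1.
  apply: (small_frobenius_center p_pr); rewrite ?oWEE ?oEE ?commg_normr //.
    by rewrite coprime_commGid ?nWEE ?coWE ?abelian_sol.
  exact: abelianS (sRW EEE) cWW.
by rewrite -ZT1 inE Tx (subsetP cGT).
Qed.

Theorem reflection_family_isog (J : {group gT}) :
    EE != set0 -> W :=: <<\bigcup_(E in EE) R E>> ->
    J :=: W <*> <<\bigcup_(E in EE) E>> ->
  [/\ p = 2 -> J \isog direct_power #|EE| 'Sym_('I_3)
    & p = 3 -> J \isog direct_power #|EE| 'Alt_('I_4)].
Proof.
move=> ntEE defW defJ.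
have dxJ : \big[dprod/1]_(E in EE) (R E <*> E)%G = J.
  rewrite reflection_dprod bigprodGE defJ.
  apply/eqP; rewrite eqEsubset gen_subG join_subG gen_subG; apply/and3P; split.
  - apply/bigcupsP=> E EEE; rewrite join_subG.
    rewrite (subset_trans (sRW EEE)) ?joing_subl //=.
    rewrite (subset_trans _ (joing_subr _ _)) // sub_gen //.
    exact: (bigcup_max E).
  - rewrite {1}defW gen_subG; apply/bigcupsP=> E EEE; rewrite sub_gen //.
    apply: (bigcup_max E) => //. exact: joing_subl.
  apply/bigcupsP=> E EEE; rewrite sub_gen //.
  by apply: (bigcup_max E) => //; apply: joing_subr.
have isoT (E : {group gT}) : E \in EE ->
    [/\ p = 2 -> R E <*> E \isog 'Sym_('I_3) & p = 3 -> R E <*> E \isog 'Alt_('I_4)].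
  move=> EEE; have solW := abelian_sol cWW.
  have RE_R := coprime_commGid (nWEE EEE) (coWE EEE) solW.
  exact: small_frobenius_isog p_pr (oWEE EEE) (oEE EEE) (commg_normr _ _) RE_R.
split=> p_eq; apply: isog_direct_power dxJ _ => E /isoT[iso2 iso3].
  exact: iso2.
exact: iso3.
Qed.

End ReflectionFamily.

(** * Modules realised inside a larger group *)

(* Makes P / 'C_P(V) act on a copy of V inside one finite group even though V is
   a subgroup of P: the ambient group is the holomorph of V. *)
Lemma holomorph_model (gT : finGroupType) (V P : {group gT}) :
    P \subset 'N(V) ->
  exists hT : finGroupType,
  exists (f : {morphism V >-> hT}) (phi : {morphism P >-> hT}),
    [/\ 'injm f, 'ker phi = 'C_P(V)
      & {in V & P, forall v g, f (v ^ g) = f v ^ phi g}].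
Proof.
move=> nVP; pose to := aut_groupAction V; exists (sdprod_groupType to).
have sP : P \subset conj_aut V @*^-1 Aut V.
  apply/subsetP=> g Pg; have Ng := subsetP nVP g Pg; apply/morphpreP; split=> //.
  by rewrite (subsetP (Aut_conj_aut V 'N(V))) // mem_morphim.
exists (sdpair1_morphism to), [morphism of restrm sP (sdpair2 to \o conj_aut V)].
split; first exact: injm_sdpair1.
  by rewrite ker_restrm ker_comp (ker_injm (injm_sdpair2 to)) -kerE ker_conj_aut.
move=> v g Vv Pg; have Ng := subsetP nVP g Pg; rewrite /= /restrm /=.
have Ag : conj_aut V g \in Aut V.
  by rewrite (subsetP (Aut_conj_aut V 'N(V))) // mem_morphim.
rewrite -sdpair_act //=; congr (sdpair1 _ _).
by rewrite /autact /= /aperm norm_conj_autE.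
Qed.

Lemma faithful_module_model (gT : finGroupType) p (V P : {group gT}) :
    P \subset 'N(V) -> p.-abelem V ->
  exists hT : finGroupType, exists (phi : {morphism P >-> hT}) (W : {group hT}),
    [/\ p.-abelem W, 'ker phi = 'C_P(V), phi @* P \subset 'N(W),
        'C_(phi @* P)(W) = 1
      & forall A : {group gT}, A \subset P ->
          #|W : 'C_W(phi @* A)| <= #|V : 'C_V(A)|].
Proof.
move=> nVP abelV; have [hT [f [phi [injf kerphi fE]]]] := holomorph_model nVP.
exists hT, phi, (f @* V)%G; split=> //=.
- exact: morphim_abelem.
- apply/subsetP=> _ /morphimP[g _ Pg ->]; rewrite inE.
  apply/subsetP=> _ /imsetP[_ /morphimP[v _ Vv ->] ->].
  by rewrite -fE // mem_morphim // memJ_norm // (subsetP nVP).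
- apply/trivgP/subsetP=> _ /setIP[/morphimP[g _ Pg ->] cVg].
  suffices: g \in 'ker phi by move/mker=> ->; apply: group1.
  rewrite kerphi inE Pg; apply/centP=> v Vv; apply/commute_sym/commgP/conjg_fixP.
  apply: (injmP injf) => //; first by rewrite memJ_norm // (subsetP nVP).
  rewrite fE //; apply/conjg_fixP/commgP/commute_sym.
  by apply: (centP cVg); apply: mem_morphim.
move=> A sAP; rewrite -(index_injm 'C_V(A)%G injf (subxx V)).
apply/dvdn_leq/indexgS; first exact: indexg_gt0.
apply/subsetP=> _ /morphimP[v _ /setIP[Vv cAv] ->]; rewrite inE mem_morphim //=.
apply/centP=> _ /morphimP[a _ Aa ->]; apply/commgP/conjg_fixP.
rewrite -fE ?(subsetP sAP) //; congr (f _); apply/conjg_fixP/commgP.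
exact: (centP cAv).
Qed.

(** * From transvections on V to reflections of an abelian image of Y *)

Section ReflectionImages.

Variables (gT rT : finGroupType) (p : nat) (G V Y E : {group gT}).
Variable theta : {morphism G >-> rT}.
Hypotheses (p_pr : prime p) (abelV : p.-abelem V).
Hypotheses (nVY : Y \subset 'N(V)) (p'Y : p^'.-group Y) (faithY : 'C_Y(V) = 1).
Hypothesis (nilY : nilpotent Y).
Hypothesis tE : transvection_group p V Y E.
Hypotheses (sYG : Y \subset G) (sEG : E \subset G).
Hypothesis cWW : abelian (theta @* Y).
Hypothesis ncWE : ~~ (theta @* E \subset 'C(theta @* Y)).

(** The image of [K = [~: Y, E]] is [[~: W, F]]. It kills ['C_K(E)], whose image F centralises, so
    its order divides p + 1; it is also 1 modulo p and not 1. *)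
Lemma card_reflection_image :
  #|[~: theta @* Y, theta @* E]| = p.+1 /\ (p = 2 \/ p = 3).
Proof.
have [oE nVE nYE oVE nCYE] := tE.
have [_ _ _ iK p23] :=
  transvection_structure p_pr abelV nVY p'Y faithY nilY oE nVE nYE oVE nCYE.
split=> //; set W := (theta @* Y)%G; set F := (theta @* E)%G.
pose K := [~: Y, E]%G; have sKY : K \subset Y by rewrite commg_subl.
have sKG := subset_trans sKY sYG.
have nWF : F \subset 'N(W) by apply: morphim_norms.
have p'W : p^'.-group W by apply: morphim_pgroup.
have pF : p.-group F by apply: morphim_pgroup; rewrite /pgroup oE pnat_id.
have coWF : coprime #|W| #|F| by rewrite coprime_sym (pnat_coprime pF).
have defR : theta @* K = [~: W, F] by rewrite morphimR.
have CR1 := coprime_abel_cent_TI nWF coWF cWW.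
have dvR : #|[~: W, F]| %| p.+1.
  have sCker : 'C_K(E) \subset 'ker theta.
    rewrite ker_trivg_morphim (subset_trans (subsetIl _ _) sKG) /= -CR1 subsetI.
    by rewrite -defR morphimS ?subsetIl //= morphim_cents ?subsetIr.
  by rewrite -iK -defR card_morphim (setIidPr sKG) indexgS.
have nRF : F \subset 'N([~: W, F]) by apply: commg_normr.
have nRF' : [acts F, on [~: W, F] | 'J] by rewrite astabsJ.
have := pgroup_fix_mod pF nRF'; rewrite afixJ CR1 cards1.
rewrite (modn_small (prime_gt1 p_pr)) => mod1.
apply/eqP; rewrite eqn_leq dvdn_leq //.
rewrite [in leqRHS](divn_eq #|[~: W, F]| p) mod1 addn1 ltnS leq_pmull // divn_gt0 ?prime_gt0 //.
rewrite leqNgt; apply/negP=> ltRp; move: mod1; rewrite modn_small // => R1.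
case/negP: ncWE; rewrite centsC; apply/commG1P.
exact/card1_trivg.
Qed.

End ReflectionImages.

(** As V is abelian, v -> [[~ t, v]] is a homomorphism on V with kernel ['C_V[t]], and its image
    contains [[~: V, <[t]>]]. *)
Lemma card_comm_cycle (gT : finGroupType) (V : {group gT}) (t : gT) :
  abelian V -> t \in 'N(V) -> #|[~: V, <[t]>]| <= #|V : 'C_V[t]|.
Proof.
move=> cVV nVt; pose g v := [~ t, v].
have Vg v : v \in V -> g v \in V.
  by move=> Vv; rewrite /g commgEr groupM // memJ_norm ?groupV // in_group.
have gM : {in V &, {morph g : u v / u * v}}.
  move=> u v Vu Vv; rewrite /g commgMJ.
  have -> : [~ t, u] ^ v = [~ t, u] by apply/conjg_fixP/commgP/(centsP cVV); rewrite ?Vg.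
  by apply: (centsP cVV); rewrite ?Vg.
pose S := (Morphism gM @* V)%G.
have sSV : S \subset V by apply/subsetP=> _ /morphimP[v Vv _ ->]; apply: Vg.
have nSt : t \in 'N(S).
  rewrite inE; apply/subsetP=> _ /imsetP[_ /morphimP[v Vv _ ->] ->].
  rewrite /= /g conjRg (_ : t ^ t = t) ?conjgE ?mulKg //.
  apply/morphimP; exists (v ^ t) => //;
  by rewrite memJ_norm.
have sRS : [~: V, <[t]>] \subset S.
  have nSV : V \subset 'N(S) by rewrite sub_abelian_norm.
  rewrite commGC -quotient_cents2 ?cycle_subG // quotient_cycle // cycle_subG.
  apply/centP=> _ /morphimP[v Nv Vv ->]; apply/commgP.
  rewrite -morphR //; apply/eqP/coset_id.
  by apply/morphimP; exists v.
apply: leq_trans (subset_leq_card sRS) _; rewrite card_morphim setIid.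
apply/dvdn_leq/indexgS; first exact: indexg_gt0.
by apply/subsetP=> v /setIP[Vv ctv]; rewrite !inE Vv /= /g; apply/commgP; apply/cent1P; rewrite cent1C.
Qed.

Lemma offender_transvection_group (gT : finGroupType) p (A V Y : {group gT}) :
    prime p -> p.-abelem V -> p.-abelem A -> A \subset 'N(V) -> Y \subset 'N(V) ->
    A \subset 'N(Y) -> p^'.-group Y -> nilpotent Y -> 'C_Y(V) = 1 ->
    'C_A(Y) = 1 -> 'C_A(V) = 1 -> A :!=: 1 -> #|V : 'C_V(A)| <= #|A| ->
  exists2 E : {group gT}, E \subset A & transvection_group p V Y E.
Proof.
move=> p_pr abelV abelA nVA nVY nYA p'Y nilY faithY cAY cAV ntA offA.
have [t [At ntt tV]] := offender_transvection p_pr abelV abelA nVA nVY nYA p'Y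
  (nilpotent_sol nilY) faithY cAY ntA offA.
have sEA : <[t]> \subset A by rewrite cycle_subG.
exists <[t]>%G => //; split; rewrite ?(subset_trans sEA) //.
- by rewrite -orderE (abelem_order_p abelA).
- have ntR : [~: V, <[t]>] != 1.
    apply: contra ntt => /eqP/commG1P; rewrite centsC => cVt.
    by rewrite -cycle_eq1 -subG1 -cAV subsetI sEA.
  have sRV : [~: V, <[t]>] \subset V by rewrite commg_subl (subset_trans sEA).
  have [_ _ [b oR]] := pgroup_pdiv (pgroupS sRV (abelem_pgroup abelV)) ntR.
  have := leq_trans (card_comm_cycle (abelem_abelian abelV) (subsetP nVA t At)) tV.
  rewrite oR -{2}(expn1 p) leq_exp2l ?(prime_gt1 p_pr) //.
  by case: b {oR} => //; rewrite expn1.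
apply: contra ntt; rewrite centsC => cEY.
by rewrite -cycle_eq1 -subG1 -cAY subsetI sEA.
Qed.
(** * The amalgam of a vertex and an edge stabiliser *)

(* When 'F(G) = 1, the normal subgroups with trivial centraliser are closed
   under intersection. *)
Lemma least_selfcentralising (gT : finGroupType) (G : {group gT}) :
    'F(G) = 1 ->
  exists S : {group gT}, [/\ S <| G, 'C_G(S) = 1, {in 'N(G), forall x, S :^ x = S}
    & forall A : {group gT}, A <| G -> 'C_G(A) = 1 -> S \subset A].
Proof.
move=> FG1.
have abel1 (A : {group gT}) : A <| G -> abelian A -> A :=: 1.
  by move=> nAG cAA; apply/trivgP; rewrite -FG1 Fitting_max ?abelian_nil.
pose sc (A : {group gT}) := (A <| G) && ('C_G(A) == 1).
have scG : sc G.
  by rewrite /sc normal_refl /=; apply/eqP/(abel1 'Z(G)%G); rewrite ?center_normal ?center_abelian.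
have [S /mingroupP[/andP[nSG /eqP CS1] minS] _] := mingroup_exists scG.
suffices minS' (A : {group gT}) : A <| G -> 'C_G(A) = 1 -> S \subset A.
  exists S; split=> // x nGx; apply/esym/eqP; rewrite eqEcard cardJg leqnn andbT.
  apply: (minS' (S :^ x)%G); first by rewrite /= -(normP nGx) normalJ.
  by rewrite /= -(normP nGx) centJ -conjIg CS1 conjs1g.
move=> nAG CA1; have [sSG nSG'] := andP nSG; have [sAG nAG'] := andP nAG.
suffices <-: S :&: A = S by apply: subsetIr.
apply: (minS (S :&: A)%G); last exact: subsetIl.
have nIG : S :&: A <| G by rewrite normalI.
rewrite /sc nIG /=; set C := 'C_G(S :&: A)%G.
have nCG : C <| G by rewrite /normal subsetIl normsI ?normG // norms_cent ?normal_norm.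
have [sCG nCG'] := andP nCG.
have CI1 : C :&: (S :&: A) = 1.
  apply: (abel1 (C :&: (S :&: A))%G); first exact: normalI.
  apply: subset_trans (subsetIr _ _) _; rewrite centsC.
  exact: subset_trans (subsetIl _ _) (subsetIr _ _).
have sCSG : C :&: S \subset G := subset_trans (subsetIl _ _) sCG.
have CS1' : C :&: S = 1.
  apply/trivgP; rewrite -CA1 subsetI sCSG /=.
  apply/commG1P/trivgP; rewrite -CI1 setIA subsetI commg_subl commg_subr.
  by rewrite (subset_trans sCSG) // normsI // (subset_trans sAG).
rewrite -subG1 -CS1 subsetI sCG; apply/commG1P/trivgP; rewrite -CS1' subsetI.
by rewrite commg_subl commg_subr (subset_trans sSG) // (subset_trans sCG).
Qed.

Lemma norm_quotient_cent (gT : finGroupType) (A F G : {group gT}) :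
  G \subset 'N(F) -> G \subset 'N(A) -> G \subset 'N(coset F @*^-1 'C(A / F)).
Proof.
move=> nFG nAG; apply: subset_trans (morphpre_norm _ _).
by rewrite -sub_quotient_pre // norms_cent // quotient_norms.
Qed.

(** For prime q this is O^q(D), the least normal subgroup of D with a q-group as quotient. *)
Definition pi'_residual (gT : finGroupType) q (D : {group gT}) :=
  <<[set g in D | q^'.-elt g]>>%G.

Lemma pi'_residual_sub (gT : finGroupType) q (D : {group gT}) :
  pi'_residual q D \subset D.
Proof. by rewrite gen_subG; apply/subsetP=> g; rewrite inE => /andP[]. Qed.

Lemma pi'_residual_norm (gT : finGroupType) q (D : {group gT}) :
  'N(D) \subset 'N(pi'_residual q D).
Proof.
rewrite norms_gen //; apply/subsetP=> x nDx; rewrite inE.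
apply/subsetP=> _ /imsetP[g /setIdP[Dg q'g] ->].
by rewrite inE memJ_norm // Dg p_eltJ.
Qed.

(** The q'-elements of DQ vanish in the q-group DQ / D. Thus whatever normalises DQ normalises the
    residual of D, even without normalising D. *)
Lemma pi'_residual_mul (gT : finGroupType) q (D Q : {group gT}) :
  q.-group Q -> Q \subset 'N(D) -> pi'_residual q (D <*> Q) = pi'_residual q D.
Proof.
move=> qQ nDQ; congr <<_>>%G; apply/setP=> g; rewrite !inE.
have [q'g | _] := boolP (q^'.-elt g); rewrite ?andbF ?andbT //.
apply/idP/idP=> [DQg | Dg]; last by rewrite (subsetP (joing_subl _ _)).
have nDg: g \in 'N(D) by rewrite (subsetP _ g DQg) // join_subG normG.
apply: coset_idr => //; apply/eqP; rewrite -order_eq1.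
have q_g : q.-elt (coset D g).
  apply: (mem_p_elt (quotient_pgroup D qQ)).
  by rewrite /= -quotientYidl // mem_quotient.
by apply/eqP; apply: pnat_1 q_g _; apply: morph_p_elt.
Qed.

Lemma pi'_residual_eq1 (gT : finGroupType) q (D : {group gT}) :
  pi'_residual q D :=: 1 -> q.-group D.
Proof.
move=> S1; apply/pgroupP=> r r_pr /(Cauchy r_pr)[g Dg og].
apply: contraT => ne_rq; have: g \in pi'_residual q D.
  by rewrite mem_gen // inE Dg /p_elt og pnatE.
by rewrite S1 => /set1P g1; move: r_pr; rewrite -og g1 order1.
Qed.

(* P, B, N and X stand for G_x, G_xy, G_x^[1] and the preimage of R in G_x, and
   tau swaps x and y.  The hypothesis semiprim says that M <| P is transitive or
   semiregular on Gamma(x), and corefree that <M, tau> is transitive on the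
   vertices whenever M is transitive on Gamma(x). *)
Section Amalgam.

Variables (gT : finGroupType) (P B N X : {group gT}) (tau : gT).
Hypotheses (sBP : B \subset P) (nsNP : N <| P) (sNB : N \subset B).
Hypotheses (nsXP : X <| P) (sNX : N \subset X) (XB_N : X :&: B = N).
Hypotheses (XB_P : X * B = P) (nilXN : nilpotent (X / N)).
Hypotheses (Btau : B :^ tau = B) (Ntau2 : (N :^ tau) :^ tau = N).
Hypothesis semiprim : forall M : {group gT},
  M <| P -> M * B = P \/ M :&: B \subset N.
Hypothesis corefree : forall Z M : {group gT},
  Z \subset B -> Z :^ tau = Z -> M \subset P -> M * B = P -> M \subset 'N(Z) ->
  Z :=: 1.

Local Notation Ny := (N :^ tau)%G.
Local Notation Py := (P :^ tau)%G.
Local Notation D := (N :&: Ny)%G.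

Let nNP : P \subset 'N(N) := normal_norm nsNP.
Let nXP : P \subset 'N(X) := normal_norm nsXP.
Let nNB : B \subset 'N(N) := subset_trans sBP nNP.
Let nXB : B \subset 'N(X) := subset_trans sBP nXP.

Let Dtau : D :^ tau = D.
Proof. by rewrite /= conjIg Ntau2 setIC. Qed.

Let nNyB : B \subset 'N(Ny).
Proof. by rewrite /= normJ -Btau conjSg. Qed.

Let sNyB : Ny \subset B.
Proof. by rewrite /= -Btau conjSg. Qed.

Let nNPy : Py \subset 'N(Ny).
Proof. by rewrite /= normJ conjSg. Qed.

Let nDB : B \subset 'N(D).
Proof. exact: normsI. Qed.

Let sDB : D \subset B.
Proof. exact: subset_trans (subsetIl _ _) sNB. Qed.

Let nDN : N \subset 'N(D) := subset_trans sNB nDB.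

Lemma semiprim_opp (M : {group gT}) : M <| Py -> M * B = Py \/ M :&: B \subset Ny.
Proof.
move=> nMP; have nMP' : M :^ tau^-1 <| P by rewrite -(normalJ _ _ tau) conjsgKV.
case: (semiprim (M := (M :^ tau^-1)%G) nMP') => /= [MB | sMB]; [left | right].
  by rewrite -{1}Btau -(conjsgKV tau M) -conjsMg MB.
by rewrite -(conjsgKV tau M) -{1}Btau -conjIg conjSg.
Qed.

Lemma corefree_opp (Z M : {group gT}) :
  Z \subset B -> Z :^ tau = Z -> M \subset Py -> M * B = Py -> M \subset 'N(Z) ->
  Z :=: 1.
Proof.
move=> sZB Zt sMP MB nZM; apply: (@corefree Z (M :^ tau^-1)%G) => //=.
- by rewrite sub_conjgV.
- by apply: (@conjsg_inj _ tau); rewrite conjsMg conjsgKV Btau.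
by rewrite sub_conjgV -normJ Zt.
Qed.

(** Let C centralise X modulo F. Then M = F(C :&: B) is normalised by X and by B, so it is normal in
    P. If MB = P then FB = P, and Dedekind's law gives X = FN = F; so M :&: B lies in N, and A with
    it. *)
Lemma quotient_faithful (F A : {group gT}) :
    F <| P -> N \subset F -> F \subset X -> F :!=: X -> A \subset B ->
    [~: X, A] \subset F ->
  A \subset N.
Proof.
move=> nsFP sNF sFX neFX sAB sXAF; have [sFP nFP] := andP nsFP.
pose C := (P :&: coset F @*^-1 'C(X / F))%G.
have nCP : P \subset 'N(C).
  by rewrite normsI ?normG // norm_quotient_cent.
have sAP := subset_trans sAB sBP; have sXP := normal_sub nsXP.
have sAC : A \subset C :&: B.
  rewrite subsetI sAB andbT subsetI sAP /=.
  rewrite -sub_quotient_pre ?(subset_trans sAP) //.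
  by rewrite quotient_cents2 ?(subset_trans sAP) ?(subset_trans sXP) // commGC.
have sXCF : [~: C, X] \subset F.
  rewrite -quotient_cents2 ?(subset_trans (normal_sub nsXP)) ?(subset_trans (subsetIl _ _)) //.
  by rewrite (subset_trans (quotientS _ (subsetIr _ _))) // cosetpreK.
pose M := (F <*> (C :&: B))%G.
have nMXB : X * B \subset 'N(M).
  rewrite mul_subG //.
    apply/subsetP=> x Xx; have Px := subsetP (normal_sub nsXP) x Xx.
    rewrite inE conjYg (normP (subsetP nFP x Px)) join_subG joing_subl /=.
    apply/subsetP=> _ /imsetP[c CBc ->]; rewrite conjg_mulR groupM //.
      exact: subsetP (joing_subr _ _) c CBc.
    have [Cc _] := setIP CBc; apply: (subsetP (joing_subl _ _)).
    by apply: (subsetP sXCF); apply: mem_commg.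
  have nCB := subset_trans sBP nCP; have nFB := subset_trans sBP nFP.
  by rewrite normsY // normsI ?normG.
have nMP : M <| P.
  by rewrite /normal join_subG sFP (subset_trans (subsetIr _ _) sBP) -XB_P.
case: (semiprim nMP) => [MB | sMB]; last first.
  by rewrite (subset_trans sAC) // (subset_trans _ sMB) // subsetI joing_subr subsetIr.
case/eqP: neFX; apply/eqP; rewrite eqEsubset sFX /=.
have FB : F * B = P.
  have: M * B \subset F * B.
    by rewrite /= norm_joinEr ?(subset_trans (subset_trans (subsetIr _ _) sBP)) // -mulgA mulgS // mul_subG ?subsetIr.
  by rewrite MB => sPFB; apply/eqP; rewrite eqEsubset mul_subG.
have eqX : F * N = X by rewrite -XB_N setIC group_modl // FB (setIidPr sXP).
by rewrite -eqX mul_subG.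
Qed.

(** The normal closure M in P of the conjugate Qy is transitive, and [[~: N, Qy]] is inside a normal
    q-subgroup of N; hence [[~: N, M]] lies in Q. So M normalises DQ and therefore the q-residual of
    D, which tau fixes as well and which is then trivial. *)
Lemma pcore_kernel_pgroup (q : nat) : ~~ ('O_q(N) \subset Ny) -> q.-group D.
Proof.
set Q := 'O_q(N)%G => nQNy; pose Qy := (Q :^ tau)%G.
have sQN : Q \subset N := pcore_sub q N.
have nQP : Q <| P by apply: gFnormal_trans.
have sQyNy : Qy \subset Ny by rewrite conjSg.
have sQyB := subset_trans sQyNy sNyB.
have nQyB : B \subset 'N(Qy).
  by rewrite /= normJ -Btau conjSg (subset_trans sBP) ?normal_norm.
have nQyN : ~~ (Qy \subset N).
  apply: contra nQNy => sQyN; rewrite -(conjSg _ _ tau).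
  by rewrite (_ : (N :^ tau) :^ tau = N).
pose M := <<class_support Qy P>>%G.
have sQyP := subset_trans sQyB sBP.
have nMP : M <| P.
  rewrite /normal gen_subG class_support_sub_norm //= ?normG //.
  by rewrite norms_gen // class_support_norm.
have sQyM : Qy \subset M by rewrite sub_gen // sub_class_support.
have MB : M * B = P.
  case: (semiprim nMP) => // sMB; case/negP: nQyN.
  by rewrite (subset_trans _ sMB) // subsetI sQyM.
have sNQy : [~: N, Qy] \subset Q.
  have sI : [~: N, Qy] \subset N :&: Qy.
    by rewrite subsetI commg_subl commg_subr (subset_trans sQyB) // (subset_trans sNB).
  apply: subset_trans sI _; apply: pcore_max.
    apply: pgroupS (subsetIr _ _) _; rewrite /= pgroupJ; exact: pcore_pgroup.
  by rewrite /normal subsetIl normsI ?normG // (subset_trans sNB).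
have nQM : M \subset 'N(Q) := subset_trans (normal_sub nMP) (normal_norm nQP).
have nQN : N \subset 'N(Q) := subset_trans (normal_sub nsNP) (normal_norm nQP).
have sNM : [~: N, M] \subset Q.
  rewrite commGC -quotient_cents2 //.
  rewrite sub_quotient_pre // gen_subG class_supportEr; apply/bigcupsP=> g Pg.
  have nCP : P \subset 'N(coset Q @*^-1 'C(N / Q)).
    by rewrite norm_quotient_cent // normal_norm.
  suffices: Qy :^ g \subset (coset Q @*^-1 'C(N / Q)) :^ g by rewrite (normsP nCP).
  have nQQy : Qy \subset 'N(Q) := subset_trans sQyP (normal_norm nQP).
  by rewrite conjSg -sub_quotient_pre // quotient_cents2 // commGC.
apply: pi'_residual_eq1; apply: (corefree (M := M)) => //.
- exact: subset_trans (pi'_residual_sub _ _) sDB.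
- by apply/normP; apply: (subsetP (pi'_residual_norm q D)); apply/normP.
- exact: normal_sub nMP.
rewrite -(pi'_residual_mul (pcore_pgroup q N)) ?(subset_trans sQN) //.
apply: subset_trans (pi'_residual_norm q (D <*> Q)).
rewrite -commg_subl (subset_trans _ (joing_subr _ _)) //.
by rewrite (subset_trans _ sNM) // commSg // join_subG subsetIl sQN.
Qed.

(* If all the 'O_q(N) lie in N :^ tau, then N and D have trivial Fitting
   subgroups and the same least self-centralising normal subgroup, which is
   therefore invariant under both P and tau. *)
Lemma edge_kernel_pcore : D :!=: 1 -> exists q : nat, ~~ ('O_q(N) \subset Ny).
Proof.
move=> ntD; have [/hasP[q _ nq] | /hasPn noq] :=
  boolP (has (fun q : nat => ~~ ('O_q(N) \subset Ny)) (primes #|N|)).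
  by exists q.
case/eqP: ntD; have PB : P * B = P by rewrite mulGSid.
have nsDN : D <| N by rewrite /normal subsetIl.
have FN1 : 'F(N) = 1.
  rewrite [LHS]big_seq; apply: big1 => q /noq/negPn sQ.
  have eqQ : 'O_q(N) = 'O_q(D).
    apply/eqP; rewrite eqEsubset; apply/andP; split.
      apply: pcore_max; first exact: pcore_pgroup.
      by rewrite /normal subsetI pcore_sub sQ (subset_trans (subsetIl _ _)) ?gFnorm.
    by apply: pcore_max; [apply: pcore_pgroup | apply: gFnormal_trans].
  apply: (corefree (Z := 'O_q(N)%G) (M := P)) => //=.
  - exact: subset_trans (pcore_sub _ _) sNB.
  - by rewrite eqQ -pcoreJ Dtau.
  exact: gFnorm_trans.
have FD1 : 'F(D) = 1.
  apply/trivgP; rewrite -FN1; apply: Fitting_max; last exact: Fitting_nil.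
  exact: gFnormal_trans.
have ZD1 : 'Z(D) = 1.
  apply/trivgP; rewrite -FD1; apply: Fitting_max; first exact: center_normal.
  exact: abelian_nil (center_abelian _).
(* ['C_N(D)] and Ny commute modulo ['Z(D) = 1], so ['C_N(D)] lies in the normal subgroup ['C_Py(Ny)]
   of Py. If this is transitive it forces D = 1; otherwise ['C_N(D)] falls into Ny, hence into
   ['Z(D)]. *)
have [C1 | ntC] := eqVneq 'C_N(D) 1; last first.
  have cCNy : 'C_N(D) \subset 'C_Py(Ny).
    have sCB : 'C_N(D) \subset B := subset_trans (subsetIl _ _) sNB.
    rewrite subsetI (subset_trans sCB) -1?Btau ?conjSg //=.
    apply/commG1P/trivgP; rewrite -ZD1.
    have sCNy : [~: 'C_N(D), Ny] \subset 'C_N(D) :&: Ny.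
      rewrite subsetI commg_subl commg_subr (subset_trans sCB) // andbT.
      by rewrite (subset_trans sNyB) // normsI // norms_cent.
    by apply: subset_trans sCNy _; rewrite setIAC.
  have nMPy : 'C_Py(Ny) <| Py.
    by rewrite /normal subsetIl normsI ?normG // norms_cent.
  have [MB | sMB] := semiprim_opp nMPy.
    apply: (corefree_opp sDB Dtau (subsetIl _ _) MB).
    by rewrite cents_norm // (subset_trans (subsetIr _ _)) // centS // subsetIr.
  case/eqP: ntC; apply/trivgP; rewrite -ZD1 subsetI subsetIr andbT subsetI subsetIl /=.
  by rewrite (subset_trans _ sMB) // subsetI cCNy (subset_trans (subsetIl _ _)).
have [SN [nSN CSN invSN minSN]] := least_selfcentralising FN1.
have [SD [nSD CSD invSD minSD]] := least_selfcentralising FD1.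
have sSND : SN \subset D := minSN D nsDN C1.
have sSDN : SD \subset SN.
  apply: minSD; first exact: normalS sSND (subsetIl _ _) nSN.
  by apply/trivgP; rewrite -CSN setSI ?subsetIl.
have nSDN : SD <| N.
  apply/andP; split; first exact: subset_trans sSDN (normal_sub nSN).
  by apply/normsP=> x Nx; apply: invSD; apply: (subsetP nDN).
(* SD is self-centralising in N too: ['C_N(SD)] commutes with D modulo ['C_D(SD) = 1], and
   ['C_N(D) = 1]. *)
have eqS : SN :=: SD.
  apply/eqP; rewrite eqEsubset sSDN andbT; apply: minSN => //.
  apply/trivgP; rewrite -C1 subsetI subsetIl; apply/commG1P/trivgP.
  rewrite -CSD /= subsetI commg_subr; apply/andP; split.
    by rewrite (subset_trans (subsetIl _ _)).
  rewrite (subset_trans _ (subsetIr N 'C(SD))) // commg_subl.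
  by rewrite normsI ?(subset_trans (subsetIl _ _) (normG _)) // norms_cent // normal_norm.
have S1 : SN :=: 1.
  apply: (corefree (M := P)) => //.
  - exact: subset_trans sSND sDB.
  - by rewrite eqS; apply: invSD; apply/normP.
  by apply/normsP=> x Px; apply: invSN; apply: (subsetP nNP).
by apply/trivgP; rewrite (subset_trans (subsetIl _ _)) // -CSN S1 subsetI subxx cents1.
Qed.

(** * The module V and the action of O on it and on X / N *)

Section PrimeDivisor.

Variable p : nat.
Hypotheses (p_pr : prime p) (pD : p %| #|D|).

Let Q := 'O_p(N)%G.
Let O := 'O_p(B)%G.

Let sQN : Q \subset N. Proof. exact: pcore_sub. Qed.
Let sOB : O \subset B. Proof. exact: pcore_sub. Qed.
Let sQB : Q \subset B := subset_trans sQN sNB.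
Let sOP : O \subset P := subset_trans sOB sBP.
Let pQ : p.-group Q. Proof. exact: pcore_pgroup. Qed.
Let pO : p.-group O. Proof. exact: pcore_pgroup. Qed.
Let nsQP : Q <| P. Proof. exact: gFnormal_trans. Qed.
Let nQP : P \subset 'N(Q) := normal_norm nsQP.
Let Otau : O :^ tau = O. Proof. by rewrite -pcoreJ Btau. Qed.

Let sXP : X \subset P := normal_sub nsXP.
Let sNP : N \subset P := normal_sub nsNP.
Let nOB : B \subset 'N(O). Proof. exact: gFnorm. Qed.

Let ntD : D :!=: 1.
Proof.
by apply: contraTneq pD => ->; rewrite cards1 dvdn1; case: eqP p_pr => // ->.
Qed.

Lemma pcore_kernel_not_sub : ~~ (Q \subset Ny) /\ p.-group D.
Proof.
have [q nq] := edge_kernel_pcore ntD; have qD := pcore_kernel_pgroup nq.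
have /eqP eqpq : p == q by have /pgroupP/(_ p p_pr pD) := qD.
by rewrite /Q eqpq.
Qed.

Let pgD : p.-group D := proj2 pcore_kernel_not_sub.

Lemma pcore_kernelE : O :&: N = Q.
Proof.
apply/eqP; rewrite eqEsubset; apply/andP; split.
  apply: pcore_max; first exact: pgroupS (subsetIl _ _) pO.
  by rewrite /normal subsetIr normsI ?normG // (subset_trans sNB).
rewrite subsetI sQN andbT; apply: pcore_max pQ _.
by rewrite /normal sQB (subset_trans sBP).
Qed.

Let sQO : Q \subset O. Proof. by rewrite -pcore_kernelE subsetIl. Qed.

(** If O were in N, the conjugate of Q by tau would lie in [O :&: N = Q], so Q would be
    tau-invariant and contained in Ny. *)
Lemma pcore_not_sub : ~~ (O \subset N).
Proof.
apply: contra (proj1 pcore_kernel_not_sub) => sON.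
have sQtO : Q :^ tau \subset O by rewrite -Otau conjSg.
have sQtQ : Q :^ tau \subset Q.
  suffices: Q :^ tau \subset O :&: N by rewrite pcore_kernelE.
  by rewrite subsetI sQtO (subset_trans sQtO).
have /eqP <- : Q :^ tau == Q by rewrite eqEcard sQtQ cardJg leqnn.
by rewrite conjSg.
Qed.

Let ntO : O :!=: 1.
Proof. by apply: contraNneq pcore_not_sub => ->; rewrite sub1G. Qed.

(** D is a normal p-subgroup of N, so it lies in Q; were ['C_P(Q)] transitive, it would centralise
    the tau-invariant D and force D = 1. *)
Lemma cent_pcore_kernel (A : {group gT}) :
  A \subset B -> A \subset 'C(Q) -> A \subset N.
Proof.
move=> sAB cAQ; have sDQ : D \subset Q.
  by apply: pcore_max pgD _; rewrite /normal subsetIl.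
have nCP : 'C_P(Q) <| P by rewrite /normal subsetIl normsI ?normG // norms_cent.
case: (semiprim nCP) => [CB | sCB].
  case/eqP: ntD; apply: (corefree sDB Dtau (subsetIl _ _) CB).
  by rewrite cents_norm // (subset_trans (subsetIr _ _)) // centS.
by rewrite (subset_trans _ sCB) // subsetI sAB andbT subsetI (subset_trans sAB sBP).
Qed.

Let V := 'Ohm_1('Z(Q))%G.
Let C := 'C_P(V)%G.

Let abelV : p.-abelem V.
Proof. by rewrite Ohm1_abelem ?center_abelian // (pgroupS (center_sub _)). Qed.

Let nsVP : V <| P.
Proof. by apply: gFnormal_trans; apply: gFnormal_trans. Qed.

Let nVP : P \subset 'N(V) := normal_norm nsVP.

Let sVZ : V \subset 'Z(Q) := Ohm_sub 1 _.

Let sVQ : V \subset Q := subset_trans sVZ (center_sub _).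

Let nsCP : C <| P.
Proof. by rewrite /normal subsetIl normsI ?normG // norms_cent. Qed.

Let sCP : C \subset P := subsetIl _ _.

(** ['Z(O)] centralises Q, so it lies in [O :&: N = Q] and thus in ['Z(Q)]. Hence C centralises the
    nontrivial tau-invariant group ['Ohm_1('Z(O))]. *)
Lemma cent_module_not_trans : C * B <> P.
Proof.
move=> CB; pose Z := 'Ohm_1('Z(O))%G.
have sZO : Z \subset O := subset_trans (Ohm_sub 1 _) (center_sub _).
have sZQ : 'Z(O) \subset 'Z(Q).
  have sZC : 'Z(O) \subset 'C(Q) := subset_trans (subsetIr _ _) (centS sQO).
  rewrite subsetI sZC andbT -pcore_kernelE subsetI center_sub.
  by apply: cent_pcore_kernel => //; apply: subset_trans (center_sub _) sOB.
have ntZ : Z :!=: 1.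
  by rewrite Ohm1_eq1 (center_nil_eq1 (pgroup_nil pO)).
case/eqP: ntZ; apply: (corefree (M := C)) => //.
- exact: subset_trans sZO sOB.
- apply/normP; rewrite -cycle_subG; apply: gFnorm_trans; apply: gFnorm_trans.
  by rewrite cycle_subG; apply/normP.
by rewrite cents_norm // (subset_trans (subsetIr _ _)) // centS // OhmS.
Qed.

Lemma cent_module_kernel : C :&: B \subset N.
Proof. by case: (semiprim nsCP) => // /cent_module_not_trans. Qed.

Lemma sub_cent_module : Q \subset C.
Proof.
rewrite subsetI (subset_trans sQB sBP) centsC.
exact: subset_trans sVZ (subsetIr _ _).
Qed.

Lemma cent_module_pcore (A : {group gT}) : A \subset O -> A \subset 'C(V) -> A \subset Q.
Proof.
move=> sAO cAV; rewrite -pcore_kernelE subsetI sAO.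
rewrite (subset_trans _ cent_module_kernel) // !subsetI cAV.
by rewrite (subset_trans sAO sOP) (subset_trans sAO sOB).
Qed.

(* If all the elementary abelian subgroups of O of maximal rank lie in Q, the
   subgroup they generate is invariant under both P and tau. *)
Lemma offender_exists : exists A : {group gT},
  [/\ A \subset O, p.-abelem A, ~~ (A \subset Q)
    & #|V : 'C_V(A)| <= #|A : A :&: Q|].
Proof.
pose n := 'r_p(O).
have [/exists_inP[A EA nAQ] | noA] :=
  boolP [exists A in 'E_p^n(O), ~~ ((A : {group gT}) \subset Q)].
  have [sAO abelA dimA] := pnElemP EA; exists A; split=> //.
  have cAV : V \subset 'C(A :&: Q).
    apply: subset_trans sVZ (subset_trans (subsetIr _ _) _).
    by rewrite centS ?subsetIr.
  have abelAV : p.-abelem ((A :&: Q) <*> V).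
    rewrite (cprod_abelem _ (cprodEY cAV)) abelV andbT.
    by apply: abelemS abelA; apply: subsetIl.
  have sAVO : (A :&: Q) <*> V \subset O.
    by rewrite join_subG (subset_trans (subsetIl _ _)) // (subset_trans sVQ).
  have leAV : #|(A :&: Q) <*> V| <= #|A|.
    rewrite (card_pgroup (abelem_pgroup abelAV)) (card_pgroup (abelem_pgroup abelA)).
    rewrite dimA leq_exp2l ?prime_gt1 // logn_le_p_rank // inE sAVO.
    exact: abelAV.
  have sIC : (A :&: Q) :&: V \subset 'C_V(A).
    rewrite subsetI subsetIr /=.
    exact: subset_trans (subset_trans (subsetIl _ _) (subsetIl _ _)) (abelem_abelian abelA).
  (* A has maximal rank in O, so the elementary abelian group generated by [A :&: Q] and V is no
     larger than A; dividing out gives the offender inequality. *)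
  have: (#|A :&: Q| * #|V| <= #|A| * #|'C_V(A)|)%N.
    by rewrite mul_cardG -(cent_joinEr cAV) leq_mul // subset_leq_card.
  rewrite -(Lagrange (subsetIl V 'C(A))) -(Lagrange (subsetIl A Q)).
  by rewrite -mulnA leq_pmul2l ?cardG_gt0 // [leqRHS]mulnC leq_pmul2l ?cardG_gt0.
pose J := <<\bigcup_(A in 'E_p^n(O)) A>>%G.
have sAQ (A : {group gT}) : A \in 'E_p^n(O) -> A \subset Q.
  by move=> EA; apply: contraNT noA => nAQ; apply/exists_inP; exists A.
have [A0 EA0] := p_rank_witness p O.
have [sA0O abelA0 dimA0] := pnElemP EA0.
have sJQ : J \subset Q by rewrite gen_subG; apply/bigcupsP.
have PB : P * B = P by rewrite mulGSid.
have JJ (x : gT) (O1 : {group gT}) : O1 :^ x = O1 ->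
    <<\bigcup_(A in 'E_p^n(O1)) (A : {group gT})>> :^ x
      \subset <<\bigcup_(A in 'E_p^n(O1)) (A : {group gT})>>.
  move=> O1x; rewrite sub_conjg gen_subG; apply/bigcupsP=> A EA.
  rewrite -sub_conjg sub_gen // (bigcup_max (A :^ x)%G) //.
  by rewrite -{1}O1x pnElemJ.
have eqE : 'E_p^n(O) = 'E_p^n(Q).
  apply/setP=> A; apply/idP/idP=> EA; last exact: (subsetP (pnElemS _ _ sQO)).
  by have [_ abelA dimA] := pnElemP EA; apply/pnElemP; rewrite sAQ.
have Jt : J :^ tau = J.
  by apply/eqP; rewrite eqEcard cardJg leqnn andbT; apply: JJ.
have nJP : P \subset 'N(J).
  apply/subsetP=> x Px; rewrite inE /= eqE; apply: JJ.
  exact: (normsP nQP).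
have J1 : J :=: 1 by apply: (corefree (M := P)); rewrite // (subset_trans sJQ).
have : A0 \subset J by rewrite sub_gen // (bigcup_max A0).
rewrite J1 => /trivgP A01; have : 0 < n.
  rewrite p_rank_gt0 mem_primes p_pr cardG_gt0 /=.
  by have [_ -> _] := pgroup_pdiv pO ntO.
by rewrite /n -dimA0 A01 cards1 logn1.
Qed.

(** Otherwise X / F0 is a nontrivial p-group, and the p-group O acts on it nilpotently, so
    [[~: X, O]] and F0 generate a proper F. Then O is trivial on X / F, against [quotient_faithful]
    and [pcore_not_sub]. *)
Lemma kernel_quotient_p' : p^'.-group (X / N).
Proof.
apply/idPn => np'; pose R := (X / N)%G.
pose F0 := (coset N @*^-1 'O_p^'(R))%G.
have sF0X : F0 \subset X.
  rewrite -(quotientGK (normalS sNX sXP nsNP)) /= -/R.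
  by rewrite morphpreS ?pcore_sub.
have sNF0 : N \subset F0 by rewrite -{1}(ker_coset N) morphpreS // sub1G.
have nF0P : P \subset 'N(F0).
  apply: subset_trans (morphpre_norm _ _); rewrite -sub_quotient_pre //.
  by apply: gFnorm_trans; apply: quotient_norms.
have nF0X := subset_trans sXP nF0P; have nF0O := subset_trans sOP nF0P.
pose F := ([~: X, O] <*> F0)%G.
have nXO : O \subset 'N(X) := subset_trans sOP nXP.
have sFX : F \subset X by rewrite join_subG sF0X commg_subl nXO.
have nFP : F <| P.
  rewrite /normal (subset_trans sFX) //= -{1}XB_P mul_subG //.
    by rewrite normsY ?commg_norml.
  by rewrite normsY ?normsR // (subset_trans sBP).
have nNX : X \subset 'N(N) := subset_trans sXP nNP.
have F0N : F0 / N = 'O_p^'(R) by rewrite /= cosetpreK.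
have pXF0 : p.-group (X / F0).
  rewrite /pgroup card_quotient // -(index_quotient_eq _ sF0X nNX); last first.
    by rewrite subIset // sNF0 orbT.
  have := nilpotent_pcore_Hall p^' nilXN; rewrite -/R -F0N.
  by case/and3P=> _ _; rewrite pnatNK.
have neFX : F :!=: X.
  apply/negP=> /eqP eqFX; have ntXF0 : X / F0 != 1.
    apply: contra np' => /eqP/trivgP; rewrite quotient_sub1 // => sXF0.
    have eqX : F0 :=: X by apply/eqP; rewrite eqEsubset sF0X.
    by rewrite -eqX F0N pcore_pgroup.
  have nXO' : O / F0 \subset 'N(X / F0) by apply: quotient_norms.
  have nilXO : nilpotent ((X / F0) <*> (O / F0)).
    by rewrite (pgroup_nil (_ : p.-group _)) //= norm_joinEr // pgroupM pXF0 quotient_pgroup.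
  have ltR : [~: X / F0, O / F0] \proper X / F0.
    apply: (nil_comm_properl nilXO (joing_subl _ _) ntXF0).
    by rewrite subsetI joing_subr.
  have : X / F0 = [~: X / F0, O / F0].
    rewrite -quotientR // -{1}eqFX /= quotientYidr //.
    by rewrite comm_subG.
  by move=> eqR; rewrite -eqR properxx in ltR.
case/negP: pcore_not_sub.
apply: (quotient_faithful nFP _ sFX neFX sOB); last exact: joing_subl.
exact: subset_trans sNF0 (joing_subr _ _).
Qed.

Let nNC : C \subset 'N(N) := subset_trans sCP nNP.

Lemma kernel_not_cover : ~~ (X \subset C <*> N).
Proof.
apply/negP=> sXCN; case: cent_module_not_trans; apply/eqP.
rewrite eqEsubset mul_subG //= -{1}XB_P.
rewrite (subset_trans (mulSg B sXCN)) // norm_joinEl // -mulgA mulgS //.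
by rewrite mul_subG.
Qed.

(** The nilpotent group X / F0 is nontrivial, so F1 is proper in X, and XC acts trivially on X / F1.
    By [quotient_faithful] its intersection with B lies in N, and Dedekind's law gives XC = X. *)
Lemma cent_module_sub : C \subset X.
Proof.
pose F0 := ((C <*> N) :&: X)%G; pose F1 := (F0 <*> [~: X, X])%G.
have nsF0P : F0 <| P by rewrite normalI // normalY.
have nF0X := subset_trans sXP (normal_norm nsF0P).
have sF0X : F0 \subset X := subsetIr _ _.
have sNF0 : N \subset F0 by rewrite subsetI joing_subr.
have sF1X : F1 \subset X by rewrite join_subG sF0X commg_subl normG.
have nsF1P : F1 <| P.
  by rewrite normalY // /normal comm_subG //= normsR.
have ntXF0 : X / F0 != 1.
  apply: contra kernel_not_cover => /eqP/trivgP; rewrite quotient_sub1 // => sXF0.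
  exact: subset_trans sXF0 (subsetIl _ _).
have nilXF0 : nilpotent (X / F0).
  have nsF0X : F0 <| X := normalS sF0X sXP nsF0P.
  have nsNX : N <| X := normalS sNX sXP nsNP.
  by rewrite -(isog_nil (third_isog sNF0 nsNX nsF0X)) quotient_nil.
have neF1X : F1 :!=: X.
  apply/negP=> /eqP eqF1X.
  have := sol_der1_proper (nilpotent_sol nilXF0) (subxx _) ntXF0.
  rewrite derg1 -quotientR //= -(quotientYidl (_ : [~: X, X] \subset 'N(F0))) ?comm_subG //.
  by rewrite -/F1 eqF1X properxx.
have nXC : C \subset 'N(X) := subset_trans sCP nXP.
have [_ sXXC] : X <*> C \subset 'N(F1) /\ [~: X, X <*> C] \subset F1.
  apply: comm_join_mod => //; rewrite ?normG ?joing_subr //.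
    exact: subset_trans sXP (normal_norm nsF1P).
  apply: subset_trans (joing_subl F0 _); rewrite subsetI commg_subl nXC andbT.
  by rewrite (subset_trans _ (joing_subl C N)) // commg_subr (subset_trans sXP) ?normal_norm.
have sAN : B :&: (X <*> C) \subset N.
  apply: (quotient_faithful nsF1P _ sF1X neF1X (subsetIl _ _)).
    exact: subset_trans sNF0 (joing_subl _ _).
  by apply: subset_trans sXXC; rewrite commgS ?subsetIr.
have <- : X * (B :&: (X <*> C)) = X.
  apply/eqP; rewrite eqEsubset mulG_subl andbT mul_subG //.
  exact: subset_trans sAN sNX.
rewrite group_modl ?joing_subl // XB_P subsetI sCP /=.
exact: joing_subr.
Qed.

Lemma cent_module_proper : C <*> N \proper X.
Proof. by rewrite properE join_subG cent_module_sub sNX kernel_not_cover. Qed.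

Lemma comm_pcore_cover : [~: X, O] <*> N = X.
Proof.
apply/eqP/idPn => neX; case/negP: pcore_not_sub.
pose F := ([~: X, O] <*> N)%G.
have nXO : O \subset 'N(X) := subset_trans sOP nXP.
have sFX : F \subset X by rewrite join_subG sNX commg_subl nXO.
apply: (@quotient_faithful F) => //; rewrite ?joing_subl ?joing_subr //.
rewrite /normal (subset_trans sFX) //= -{1}XB_P mul_subG //.
  by rewrite normsY ?commg_norml // (subset_trans sXP).
by rewrite normsY ?normsR.
Qed.

Theorem amalgam_reflections : exists J F : {group gT},
  [/\ J <| P, F <| P, N \subset F, F \proper X & X \proper J] /\
  ((p = 2 /\ exists2 k : nat, 0 < k & J / F \isog direct_power k 'Sym_('I_3)) \/
   (p = 3 /\ exists2 k : nat, 0 < k & J / F \isog direct_power k 'Alt_('I_4))).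
Proof.
pose gF (H : {group gT}) := (H <| P) && (H \proper X).
have gCN : gF (C <*> N)%G by rewrite /gF cent_module_proper normalY.
have [F /maxgroupP[/andP[nsFP ltFX] maxF] sCNF] := maxgroup_exists gCN.
have [sFP nFP] := andP nsFP; have [sFX nsXF] := andP ltFX.
have [sCF sNF] : C \subset F /\ N \subset F.
  by rewrite !(subset_trans _ sCNF) ?joing_subl ?joing_subr.
have nFX := subset_trans sXP nFP.
have nFO := subset_trans sOP nFP.
have neFX : F :!=: X by apply: contra nsXF => /eqP->.
pose W := (X / F)%G.
have ntW : W :!=: 1 by rewrite -subG1 quotient_sub1.
have minW : minnormal W (P / F).
  apply/mingroupP; rewrite ntW quotient_norms //; split=> // H /andP[ntH nHP] sHW.
  pose H1 := (coset F @*^-1 H)%G.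
  have H1F : H1 / F = H by rewrite /= cosetpreK.
  have sH1X : H1 \subset X.
    by rewrite -(quotientGK (normalS sFX sXP nsFP)) morphpreS.
  have sFH1 : F \subset H1 by rewrite -{1}(ker_coset F) morphpreS // sub1G.
  apply/eqP; rewrite eqEsubset sHW /= -H1F quotientS //; apply: contraT => nsXH1.
  case/eqP: ntH; rewrite -H1F (maxF H1) ?trivg_quotient //.
  rewrite /gF properE sH1X nsXH1 /normal (subset_trans sH1X sXP) !andbT /=.
  by apply: subset_trans (morphpre_norm _ _); rewrite -sub_quotient_pre.
have isoW : (X / N) / (F / N) \isog W.
  by apply: third_isog => //; apply: normalS sXP _.
have nilW : nilpotent W by rewrite -(isog_nil isoW) quotient_nil.
have p'W : p^'.-group W.
  rewrite /pgroup -(card_isog isoW); apply: quotient_pgroup.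
  exact: kernel_quotient_p'.
have [_ _ /is_abelemP[r r_pr abelW]] :=
  minnormal_solvable minW (subxx _) (nilpotent_sol nilW).
have cWW := abelem_abelian abelW.
have WB : W * (B / F) = P / F by rewrite -quotientMl // XB_P.
have faithOW (A : {group gT}) : A \subset O -> A / F \subset 'C(W) -> A \subset Q.
  move=> sAO cAW; rewrite -pcore_kernelE subsetI sAO.
  apply: (quotient_faithful nsFP sNF sFX neFX (subset_trans sAO sOB)).
  by rewrite commGC -quotient_cents2 ?(subset_trans sAO).
have [hT [phi [Vh [abelVh kerphi nVhP faithP indexV]]]] :=
  faithful_module_model nVP abelV.
have kerC : 'ker phi = C by [].
have subC (A : {group gT}) : A \subset P -> (A \subset C) = (phi @* A \subset [1]%g).
  by move=> sAP; rewrite -[in LHS]kerC ker_trivg_morphim sAP.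
have nRP : P \subset 'N([~: X, O]).
  by rewrite -{1}XB_P mul_subG ?commg_norml // normsR.
have cON : phi @* O \subset 'C(phi @* N).
  apply/commG1P/trivgP; rewrite /= commGC -morphimR //.
  rewrite -(subC [~: N, O]%G) ?(comm_subG sNP sOP) //.
  apply: subset_trans sub_cent_module; rewrite -pcore_kernelE subsetI.
  by rewrite commg_subl commg_subr (subset_trans sOB nNB) (subset_trans sNB nOB).
have nXOh : phi @* O \subset 'N(phi @* X) by rewrite morphim_norms // (subset_trans sOP).
have cKN : [~: phi @* X, phi @* O] \subset 'C(phi @* N).
  by apply: comm_norm_cent_cent => //; rewrite morphim_norms // (subset_trans sXP).
have sKX : [~: phi @* X, phi @* O] \subset phi @* X by rewrite commg_subl.
(* Its lower central series enters [phi @* N], as X / N is nilpotent, and one further term is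
   trivial because [phi @* N] is centralised. *)
have nilKh : nilpotent [~: phi @* X, phi @* O].
  have [n LXN] := lcnP _ nilXN; apply/lcnP; exists n.+1; rewrite lcnSn.
  apply/commG1P; rewrite centsC (subset_trans cKN) // centS //.
  apply: subset_trans (lcnS _ sKX) _; rewrite -morphim_lcn //; apply: morphimS.
  rewrite -quotient_sub1 ?(subset_trans (lcn_sub _ _)) ?(subset_trans sXP) //.
  by rewrite /quotient (morphim_lcn (coset_morphism N)) ?LXN // (subset_trans sXP).
pose Yh := 'O_p^'([~: phi @* X, phi @* O])%G.
have nYhP : phi @* P \subset 'N(Yh).
  have nKP : phi @* P \subset 'N([~: phi @* X, phi @* O]).
    by rewrite -morphimR // morphim_norms.
  exact: gFnorm_trans.
have sYhX : Yh \subset phi @* X := subset_trans (pcore_sub _ _) sKX.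
have sYhP : Yh \subset phi @* P := subset_trans sYhX (morphimS phi sXP).
have nNhX : phi @* X \subset 'N(phi @* N) by rewrite morphim_norms // (subset_trans sXP).
(* [comm_pcore_cover] gives the product with the whole nilpotent group; its p-part is absorbed by
   [phi @* N], since X / N is a p'-group. *)
have YhN : phi @* X = Yh * phi @* N.
  have sKpN : 'O_p([~: phi @* X, phi @* O]) \subset phi @* N.
    have sKpX := subset_trans (pcore_sub p _) sKX.
    rewrite -quotient_sub1 ?(subset_trans sKpX) //.
    have pK : p.-group ('O_p([~: phi @* X, phi @* O]) / phi @* N).
      by rewrite quotient_pgroup ?pcore_pgroup.
    have p'X : p^'.-group (phi @* X / phi @* N).
      rewrite /pgroup card_quotient //; apply: pnat_dvd (index_morphim phi _) _; first by rewrite subIset ?sXP.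
      rewrite -card_quotient ?(subset_trans sXP) //; exact: kernel_quotient_p'.
    by rewrite -(coprime_TIg (pnat_coprime pK p'X)) subsetI subxx quotientS.
  have [_ /= defK _ _] := dprodP (nilpotent_pcoreC p^' nilKh).
  have sON : 'O_p^'^'([~: phi @* X, phi @* O]) \subset phi @* N.
    by rewrite (eq_pcore _ (negnK p)).
  have mX : phi @* ([~: X, O] <*> N) = [~: phi @* X, phi @* O] * phi @* N.
    have sRP : [~: X, O] \subset P by rewrite (comm_subG sXP sOP).
    by rewrite norm_joinEl ?morphimMl ?morphimR // (subset_trans sRP).
  by rewrite -{1}comm_pcore_cover mX -{1}defK -mulgA (mulSGid sON).
have p'Yh : p^'.-group Yh := pcore_pgroup _ _.
have nilYh : nilpotent Yh := nilpotentS (pcore_sub _ _) nilKh.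
have nVhY := subset_trans sYhP nVhP.
have faithY : 'C_Yh(Vh) = 1 by apply/trivgP; rewrite -faithP setSI.
have sOhP : phi @* O \subset phi @* P := morphimS phi sOP.
have cOY (A : {group gT}) : A \subset O -> phi @* A \subset 'C(Yh) -> A \subset Q.
  move=> sAO cAY; have sAP := subset_trans sAO sOP.
  rewrite -pcore_kernelE subsetI sAO.
  apply: (quotient_faithful nsFP sNF sFX neFX (subset_trans sAO sOB)).
  apply: subset_trans sCF; rewrite (subC [~: X, A]%G) ?(comm_subG sXP sAP) //=.
  rewrite morphimR //; apply/trivgP/commG1P; rewrite YhN centsC.
  by rewrite centM subsetI cAY (subset_trans (morphimS phi sAO)).
have [A [sAO abelA nAQ offA]] := offender_exists.
have sAP := subset_trans sAO sOP.
have [E sEA tE] : exists2 E : {group hT}, E \subset phi @* A & transvection_group p Vh Yh E.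
  have sAhP : phi @* A \subset phi @* P := morphimS phi sAP.
  apply: (offender_transvection_group p_pr) => //.
  - exact: morphim_abelem.
  - exact: subset_trans sAhP nVhP.
  - exact: subset_trans sAhP nYhP.
  - apply/trivgP/subsetP=> _ /setIP[/morphimP[a Pa Aa ->] cYa].
    have : <[a]> \subset Q.
      by apply: cOY; rewrite ?cycle_subG ?(subsetP sAO) // morphim_cycle // cycle_subG.
    rewrite cycle_subG => Qa; apply/set1P/mker; rewrite kerC.
    exact: subsetP sub_cent_module a Qa.
  - by apply/trivgP; rewrite -faithP setSI.
  - apply: contra nAQ => /eqP/trivgP; rewrite -subC // => sAC.
    by apply: cent_module_pcore => //; apply: subset_trans sAC (subsetIr _ _).
  (* [A :&: C = A :&: Q], so [phi @* A] has order exactly [#|A : A :&: Q|]. *)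
  apply: leq_trans (indexV A sAP) (leq_trans offA _).
  rewrite card_morphim (setIidPr sAP) kerC -(indexgI A C) (_ : A :&: C = A :&: Q) //.
  apply/eqP; rewrite eqEsubset andbC (setIS A sub_cent_module) subsetI subsetIl /=.
  apply: (@cent_module_pcore (A :&: C)%G); first exact: subset_trans (subsetIl _ _) sAO.
  by rewrite (subset_trans (subsetIr _ _)) // subsetIr.
have kerF : 'ker phi \subset 'ker (restrm nFP (coset F)).
  by rewrite ker_restrm ker_coset kerC subsetI sCP.
pose theta := factm_morphism kerF (subxx P).
have thetaE (H : {group gT}) : H \subset P -> theta @* (phi @* H) = H / F.
  by move=> sHP; rewrite morphim_factm morphim_restrm (setIidPr sHP).
have thetaY : theta @* Yh = W.
  have := thetaE X sXP; rewrite YhN morphimMl // thetaE //.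
  by rewrite (trivgP (_ : N / F \subset [1]%g)) ?mulg1 // quotient_sub1 // (subset_trans sNP).
have sEO : E \subset phi @* O := subset_trans sEA (morphimS phi sAO).
(* Conjugating by B only keeps the groups inside the image of O, where they generate p-groups;
   nothing is lost, as P / F is W times B / F. *)
pose EE := orbit 'JG%act (B / F) (theta @* E)%G.
have EEP (E1 : {group coset_of F}) : E1 \in EE ->
    exists2 E2 : {group hT}, E1 = (theta @* E2)%G
      & E2 \subset phi @* O /\ transvection_group p Vh Yh E2.
  case/orbitP=> _ /morphimP[b nFb Bb ->] <-.
  have Pb := subsetP sBP b Bb; have Phb : phi b \in phi @* P := mem_morphim phi Pb Pb.
  exists (E :^ phi b)%G; last split.
  - have thb : theta (phi b) = coset F b := factmE kerF (subxx P) Pb.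
    by apply: group_inj; rewrite /= morphimJ // thb.
  - have <- : (phi @* O) :^ phi b = phi @* O.
      by rewrite -morphimJ // (normsP nOB).
    by rewrite conjSg.
  apply: transvection_groupJ tE.
  by rewrite inE (subsetP nVhP) // (subsetP nYhP).
have faithO (E2 : {group hT}) : E2 \subset phi @* O -> theta @* E2 \subset 'C(W) -> E2 :=: 1.
  move=> sE2O cE2W; apply/trivgP/subsetP=> z E2z.
  have /morphimP[o Po Oo zo] := subsetP sE2O z E2z.
  have : <[o]> \subset Q.
    apply: faithOW; first by rewrite cycle_subG.
    rewrite -thetaE ?cycle_subG //; apply: subset_trans cE2W; apply: morphimS.
    by rewrite morphim_cycle // -zo cycle_subG.
  rewrite cycle_subG zo => Qo; apply/set1P/mker; rewrite kerC.
  exact: subsetP sub_cent_module o Qo.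
have sEEO (E2 : {group hT}) : E2 \subset phi @* O -> E2 \subset phi @* P.
  by move=> sE2O; apply: subset_trans sE2O sOhP.
have ncW (E2 : {group hT}) : E2 \subset phi @* O -> transvection_group p Vh Yh E2 ->
    ~~ (theta @* E2 \subset 'C(W)).
  move=> sE2O [oE2 _ _ _ _]; apply/negP=> /(faithO _ sE2O) E21.
  by move: oE2 (prime_gt1 p_pr); rewrite E21 cards1 => <-.
have oEE : {in EE, forall E1 : {group coset_of F}, #|E1| = p}.
  move=> E1 /EEP[E2 -> [sE2O tE2]]; have [oE2 _ _ _ _] := tE2.
  have /primeP[_ /(_ #|theta @* E2|)] := p_pr.
  rewrite -{1}oE2 dvdn_morphim => /(_ isT)/pred2P[/eqP | //].
  rewrite -trivg_card1 => /eqP thE2; case/negP: (ncW E2 sE2O tE2).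
  by rewrite thE2 sub1G.
have sEEP : {in EE, forall E1 : {group coset_of F}, E1 \subset P / F}.
  by move=> E1 /EEP[E2 -> [sE2O _]]; rewrite /= -thetaE // morphimS // sEEO.
have nWP : P / F \subset 'N(W) by rewrite quotient_norms.
have nWEE : {in EE, forall E1 : {group coset_of F}, E1 \subset 'N(W)}.
  by move=> E1 EE1; apply: subset_trans (sEEP E1 EE1) nWP.
have refl (E2 : {group hT}) : E2 \subset phi @* O -> transvection_group p Vh Yh E2 ->
    #|[~: W, theta @* E2]| = p.+1 /\ (p = 2 \/ p = 3).
  move=> sE2O tE2; have := ncW _ sE2O tE2; have := cWW; rewrite -thetaY => cYY ncY.
  exact: card_reflection_image p_pr abelVh nVhY p'Yh faithY nilYh tE2 sYhP (sEEO _ sE2O) cYY ncY.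
have oWEE : {in EE, forall E1 : {group coset_of F}, #|[~: W, E1]| = p.+1}.
  by move=> E1 /EEP[E2 -> [sE2O tE2]]; have [] := refl E2 sE2O tE2.
have sYEE (E2 F2 : {group hT}) : E2 \subset phi @* O -> F2 \subset phi @* O ->
  E2 <*> F2 \subset phi @* O by move=> sE2 sF2; rewrite join_subG sE2.
have cEE : {in EE &, forall E1 F1 : {group coset_of F}, F1 \subset 'C(E1)}.
  move=> E1 F1 /EEP[E2 -> [sE2O tE2]] /EEP[F2 -> [sF2O tF2]].
  apply: morphim_cents; have sEF := sYEE _ _ sE2O sF2O.
  apply: (transvections_commute p_pr abelVh nVhY p'Yh faithY nilYh tE2 tF2).
    by apply: pgroupS sEF _; apply: morphim_pgroup.
  by apply/trivgP; rewrite -faithP setSI // (subset_trans sEF).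
have faithEE : {in EE &, forall E1 F1 : {group coset_of F}, 'C_(E1 <*> F1)(W) = 1}.
  move=> E1 F1 /EEP[E2 -> [sE2O tE2]] /EEP[F2 -> [sF2O tF2]] /=.
  have sEF := sYEE _ _ sE2O sF2O.
  rewrite -morphimY ?sEEO //; apply/trivgP/subsetP=> _ /setIP[/morphimP[g Pg EFg ->] cWg].
  have g1 : <[g]> = 1.
    apply: faithO; first by rewrite cycle_subG (subsetP sEF).
    by rewrite morphim_cycle // cycle_subG.
  have /set1P -> : g \in [1 hT] by rewrite -g1 cycle_id.
  by rewrite morph1 set11.
have EEE : (theta @* E)%G \in EE by apply: orbit_refl.
have EEJ (E1 : {group coset_of F}) b : b \in B / F -> E1 \in EE -> (E1 :^ b)%G \in EE.
  move=> Bb /orbitP[a Ba <-]; rewrite -[(_ :^ b)%G]/('JG%act _ b) -actM.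
  by rewrite mem_orbit ?groupM.
have sBFP : B / F \subset P / F by rewrite quotientS.
(* The right side is normalised by B / F, which permutes EE, and by the abelian W; minimality of W
   does the rest. *)
have defW : W :=: <<\bigcup_(E1 in EE) [~: W, E1]%G>>.
  pose U := <<\bigcup_(E1 in EE) [~: W, E1]%G>>%G.
  have sUW : U \subset W.
    by rewrite gen_subG; apply/bigcupsP=> E1 EE1; rewrite commg_subl nWEE.
  have [_ minW'] := mingroupP minW; apply/esym; apply: (minW' U) => //.
  apply/andP; split.
    have [oWE _] := refl E sEO tE; apply/negP=> /eqP U1.
    have : [~: W, theta @* E] \subset U by rewrite sub_gen // (bigcup_max (theta @* E)%G).
    by rewrite U1 => /subset_leq_card; rewrite cards1 oWE ltnNge prime_gt0.
  rewrite -WB mul_subG //; first exact: subset_trans cWW (cents_norm (centS sUW)).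
  rewrite norms_gen //; apply/subsetP=> b Bb; rewrite inE.
  rewrite sub_conjg; apply/bigcupsP=> E1 EE1; rewrite -sub_conjg /= conjsRg.
  rewrite (normsP nWP b (subsetP sBFP b Bb)).
  exact: (bigcup_max (E1 :^ b)%G (EEJ _ _ Bb EE1)).
pose J0 := (W <*> <<\bigcup_(E1 in EE) E1>>)%G.
have ntEE : EE != set0 by apply/set0Pn; exists (theta @* E)%G.
have [iso2 iso3] := reflection_family_isog p_pr p'W cWW oEE nWEE oWEE cEE faithEE
  ntEE defW (erefl (gval J0)).
have sJ0P : J0 \subset P / F.
  rewrite join_subG quotientS //= gen_subG; exact/bigcupsP.
pose J := (coset F @*^-1 J0)%G.
have JF : J / F = J0 by rewrite /= cosetpreK.
have sJP : J \subset P by rewrite -(quotientGK nsFP) morphpreS.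
exists J, F; split.
  split=> //.
    rewrite /normal sJP; apply: subset_trans (morphpre_norm _ _).
    rewrite -sub_quotient_pre //= -WB mul_subG //.
      exact: subset_trans (joing_subl _ _) (normG J0).
    rewrite normsY ?(subset_trans sBFP nWP) // norms_gen //; apply/subsetP=> b Bb; rewrite inE.
    rewrite sub_conjg; apply/bigcupsP=> E1 EE1; rewrite -sub_conjg.
    exact: (bigcup_max (E1 :^ b)%G (EEJ _ _ Bb EE1)).
  rewrite properE; apply/andP; split.
    by rewrite -(quotientGK (normalS sFX sXP nsFP)) morphpreS ?joing_subl.
  apply/negP=> sJX; have sEJ : theta @* E \subset J0.
    apply: subset_trans (joing_subr _ _).
    by rewrite sub_gen // (bigcup_max (theta @* E)%G).
  have sEW : theta @* E \subset W by rewrite (subset_trans sEJ) // -JF quotientS.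
  have := pgroupS sEW p'W; rewrite /pgroup (oEE _ EEE) pnatE // !inE.
  by rewrite eqxx.
have k_gt0 : 0 < #|EE| by apply/card_gt0P; exists (theta @* E)%G.
have [_ [p2 | p3]] := refl E sEO tE.
  by left; split=> //; exists #|EE|; rewrite // JF; apply: iso2.
by right; split=> //; exists #|EE|; rewrite // JF; apply: iso3.
Qed.

End PrimeDivisor.

End Amalgam.

Lemma morphim_quotient_isog (aT rT : finGroupType) (D J F : {group aT})
    (f : {morphism D >-> rT}) :
  J \subset D -> F <| J -> 'ker_J f \subset F -> J / F \isog f @* J / f @* F.
Proof.
move=> sJD nsFJ kerFJ; pose g := restrm_morphism sJD f.
have injg : 'injm (quotm g nsFJ).
  by rewrite ker_quotm ker_restrm quotient_sub1 // (subset_trans (subsetIl _ _)) ?normal_norm.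
have := sub_isog (subxx (J / F)) injg; rewrite morphim_quotm !morphim_restrm setIid.
by rewrite (setIidPr (normal_sub nsFJ)).
Qed.

(** * Vertex stabilisers of a graph *)

Section RestrictedAction.

Variables (T : finType) (S : {set T}) (M : {group {perm T}}).
Hypothesis nSM : M \subset 'N(S | 'P).

Lemma restr_perm_orbit w : w \in S ->
  orbit 'P (restr_perm S @* M) w = orbit 'P M w.
Proof.
move=> Sw; apply/setP=> u; apply/orbitP/orbitP=> [[_ /morphimP[m nSm Mm ->]] | [m Mm]] <-.
  by exists m; rewrite //= /aperm restr_permE.
exists (restr_perm S m); first by rewrite mem_morphim // (subsetP nSM).
by rewrite /= /aperm restr_permE // (subsetP nSM).
Qed.

Lemma restr_perm_trans :
  [transitive restr_perm S @* M, on S | 'P] = [transitive M, on S | 'P].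
Proof. by rewrite /atrans (eq_in_imset restr_perm_orbit). Qed.

Lemma restr_perm_semiregular w :
  semiregular_on S (restr_perm S @* M) -> w \in S -> 'C_M[w | 'P] \subset 'C(S | 'P).
Proof.
move=> semS Sw; apply/subsetP=> m /setIP[Mm /astab1P /= mw].
have nSm := subsetP nSM m Mm; rewrite -ker_restr_perm; apply/(kerP _ nSm).
have : restr_perm S m \in 'C_(restr_perm S @* M)[w | 'P].
  by rewrite inE mem_morphim //=; apply/astab1P; rewrite /= /aperm restr_permE.
by rewrite (semS w Sw) => /set1P.
Qed.

End RestrictedAction.

Section VertexStabilisers.

Variables (T : finType) (e : rel T) (G : {group {perm T}}).
Hypotheses (eG : G \subset graph_aut e) (sym_e : symmetric e).

Lemma graph_autE g u v : g \in G -> e (g u) (g v) = e u v.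
Proof.
by move/(subsetP eG); rewrite inE => /forallP/(_ u)/forallP/(_ v)/eqP.
Qed.

Lemma stab_norm_nbrs v : 'C_G[v | 'P] \subset 'N(nbrs e v | 'P).
Proof.
apply/subsetP=> g /setIP[Gg /astab1P /= gv]; rewrite !inE /=.
apply/subsetP=> w; rewrite !inE /= => vw.
by rewrite -[v in e v _]gv /= /aperm graph_autE.
Qed.

Definition nbrs_kernel v : {group {perm T}} := 'C_('C_G[v | 'P])(nbrs e v | 'P)%G.

Lemma nbrs_kernelP v g : reflect
  [/\ g \in G, g v = v & {in nbrs e v, forall w, g w = w}] (g \in nbrs_kernel v).
Proof.
apply: (iffP idP) => [/setIP[/setIP[Gg /astab1P gv] /astabP gS] // | [Gg gv gS]].
apply/setIP; split; last exact/astabP.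
by apply/setIP; split=> //; apply/astab1P.
Qed.

Lemma nbrs_kernelJ v g : g \in G -> nbrs_kernel v :^ g = nbrs_kernel (g v).
Proof.
have subJ u h : h \in G -> nbrs_kernel u :^ h \subset nbrs_kernel (h u).
  move=> Gh; apply/subsetP=> _ /imsetP[k /nbrs_kernelP[Gk ku kS] ->].
  apply/nbrs_kernelP; split; first by rewrite groupJ.
    by rewrite permJ ku.
  move=> w; rewrite inE -{1}[w](permKV h) graph_autE // => uw.
  by rewrite -[w in LHS](permKV h) permJ kS ?inE // permKV.
move=> Gg; apply/eqP; rewrite eqEsubset subJ //= -sub_conjgV.
by have := subJ (g v) g^-1; rewrite permK groupV; apply.
Qed.

(** Each of x and y is a neighbour of the other, so fixing both neighbourhoods pointwise already
    fixes x and y. *)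
Lemma edge_kernelE x y : e x y ->
  edge_kernel e G x y :=: nbrs_kernel x :&: nbrs_kernel y.
Proof.
move=> exy; have eyx : e y x by rewrite sym_e.
apply/setP=> g; rewrite [RHS]inE; apply/setIP/andP.
  case=> [/setIP[Gg _] /astabP gS].
  have gx : g x = x by apply: gS; rewrite !inE eyx orbT.
  have gy : g y = y by apply: gS; rewrite !inE exy.
  by split; apply/nbrs_kernelP; split=> // w Sw; apply: gS; rewrite inE Sw ?orbT.
case=> /nbrs_kernelP[Gg gx gSx] /nbrs_kernelP[_ gy gSy]; split.
  rewrite inE Gg !inE /=; apply/subsetP=> w; rewrite !inE /= /aperm.
  by case/pred2P=> ->; rewrite ?gx ?gy eqxx ?orbT.
by apply/astabP=> w; rewrite inE => /orP[/gSx | /gSy].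
Qed.

(** The H-orbit of x is closed under adjacency: a neighbour of [h x] is the image under h of a
    neighbour of x, which M reaches from [y = t x]. *)
Lemma connected_transitive (H M : {group {perm T}}) x y t :
    connected_graph e -> H \subset G -> M \subset H -> t \in H -> t x = y ->
    [transitive M, on nbrs e x | 'P] -> y \in nbrs e x ->
  [transitive H, on [set: T] | 'P].
Proof.
move=> conn sHG sMH Ht tx trM Sy; apply/imsetP; exists x; rewrite ?inE //.
apply/eqP; rewrite eq_sym -subTset; apply/subsetP=> v _.
have clO : closed e (orbit 'P H x).
  apply: intro_closed; first exact: sym_connect_sym.
  move=> u w euw /orbitP[h Hh hx]; rewrite /= /aperm in hx.
  have Gh := subsetP sHG h Hh.
  have Sw : h^-1 w \in nbrs e x by rewrite inE -(graph_autE _ _ Gh) permKV hx.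
  have [m Mm mw] := atransP2 trM Sy Sw; rewrite /= /aperm in mw.
  apply/orbitP; exists (t * m * h); first by rewrite !groupM // (subsetP sMH).
  by rewrite /= /aperm !permM tx -mw permKV.
by rewrite -(closed_connect clO (conn x v)) orbit_refl.
Qed.

End VertexStabilisers.

Theorem corollary1p3 (T : finType) (e : rel T) (G : {group {perm T}})
    (he : simple_graph e) (hconn : connected_graph e)
    (hG : G \subset graph_aut e) (harc : arc_transitive e G)
    (hloc : forall v : T,
       semiprimitive (nbrs e v) (local_group e G v) /\
       exists R : {group {perm T}},
         regular_normal_nilpotent (nbrs e v) (local_group e G v) R)
    (x y : T) (hxy : e x y) (hker : edge_kernel e G x y :!=: 1)
    (p : nat) (hp : prime p) (hpdvd : p %| #|edge_kernel e G x y|)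
    (R : {group {perm T}})
    (hR : regular_normal_nilpotent (nbrs e x) (local_group e G x) R) :
  exists J F : {group {perm T}},
    [/\ J <| local_group e G x, F <| local_group e G x,
        F \proper R, R \proper J &
        (p = 2 /\ exists2 k : nat, 0 < k &
           J / F \isog direct_power k 'Sym_('I_3)) \/
        (p = 3 /\ exists2 k : nat, 0 < k &
           J / F \isog direct_power k 'Alt_('I_4))].
Proof.
have [sym_e _] := he; have eyx : e y x by rewrite sym_e.
pose S := nbrs e x; pose P := 'C_G[x | 'P]%G; pose B := 'C_P[y | 'P]%G.
pose N := nbrs_kernel e G x; pose rho := restr_perm_morphism S.
have nSP : P \subset 'N(S | 'P) by apply: stab_norm_nbrs.
have Sy : y \in S by rewrite inE.
have [[trL semL] _] := hloc x; have [nRL [trR semR] nilR] := hR.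
have trP : [transitive P, on S | 'P] by rewrite -restr_perm_trans.
have sBP : B \subset P := subsetIl _ _.
have nsNP : N <| P.
  rewrite /normal subsetIl normsI ?normG //.
  exact: subset_trans nSP (normal_norm (astab_normal _ _)).
have sNB : N \subset B.
  apply/subsetP=> g /nbrs_kernelP[Gg gx gS].
  by apply/setIP; split; [apply/setIP; split=> // | ]; apply/astab1P; rewrite //= /aperm gS.
(* The transitivity criterion yields the product in the order B * M; inversion reverses it. *)
have mulB (M : {group {perm T}}) : M \subset P ->
    reflect (M * B = P) [transitive M, on S | 'P].
  move=> sMP; apply: (iffP (subgroup_transitiveP Sy sMP trP)) => defP.
    by rewrite -(invGid M) -(invGid B) -invMg defP invGid.
  by rewrite -(invGid M) -['C_P[y | 'P]](invGid B) -invMg defP invGid.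
have kerP (M : {group {perm T}}) : M \subset P ->
    semiregular_on S (rho @* M) -> M :&: B \subset N.
  move=> sMP semM; rewrite subsetI (subset_trans (subsetIl _ _)) //=.
  apply: subset_trans (restr_perm_semiregular (subset_trans sMP nSP) semM Sy).
  by rewrite setIS // subsetIr.
pose X := (P :&: rho @*^-1 R)%G.
have sXP : X \subset P := subsetIl _ _.
have rhoX : rho @* X = R by rewrite /= morphim_setIpre (setIidPr (normal_sub nRL)).
have nsXP : X <| P.
  rewrite /normal sXP normsI ?normG //; apply: subset_trans (morphpre_norm _ _).
  by rewrite -sub_morphim_pre // normal_norm.
have sNX : N \subset X.
  rewrite subsetI subsetIl /=; apply: subset_trans (subsetIr _ _) _.
  by rewrite -(ker_restr_perm S) morphpreS // sub1G.
have XB_N : X :&: B = N.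
  by apply/eqP; rewrite eqEsubset subsetI sNX sNB kerP // (group_inj rhoX : (rho @* X)%G = R).
have XB_P : X * B = P.
  by apply/(mulB X sXP); rewrite -restr_perm_trans ?rhoX // (subset_trans sXP).
have nilXN : nilpotent (X / N).
  have kerX : 'ker_X rho = N.
    rewrite ker_restr_perm; apply/eqP; rewrite eqEsubset setSI //= subsetI sNX.
    exact: subsetIr.
  have isoX : X / N \isog R.
    by rewrite -kerX -rhoX; apply: first_isog_loc (subset_trans sXP nSP).
  by rewrite (isog_nil isoX).
have [tau Gt [tx ty]] := harc x y y x hxy eyx.
have Btau : B :^ tau = B.
  have CJ v : 'C_G[v | 'P] :^ tau = 'C_G[tau v | 'P].
    by rewrite conjIg conjGid // -astab1_act.
  have -> : B :=: 'C_G[x | 'P] :&: 'C_G[y | 'P] by rewrite -setIIr setIA.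
  by rewrite conjIg !CJ tx ty setIC.
have Nt : N :^ tau = nbrs_kernel e G y by rewrite nbrs_kernelJ ?tx.
have Ntau2 : (N :^ tau) :^ tau = N by rewrite Nt nbrs_kernelJ ?ty.
have semiprim (M : {group {perm T}}) : M <| P -> M * B = P \/ M :&: B \subset N.
  move=> nMP; have sMP := normal_sub nMP.
  have [trM | semM] := semL _ (morphim_normal rho nMP).
    by left; apply/(mulB M sMP); rewrite -restr_perm_trans // (subset_trans sMP).
  by right; apply: kerP.
(* M and tau generate a vertex-transitive group normalising Z. Elements of Z fix x, hence, after
   conjugation, every vertex. *)
have corefree (Z M : {group {perm T}}) :
    Z \subset B -> Z :^ tau = Z -> M \subset P -> M * B = P -> M \subset 'N(Z) -> Z :=: 1.
  move=> sZB Zt sMP MB nZM; pose H := (M <*> <[tau]>)%G.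
  have nZH : H \subset 'N(Z) by rewrite join_subG nZM cycle_subG; apply/normP.
  have sHG : H \subset G.
    by rewrite join_subG cycle_subG Gt (subset_trans sMP) // subsetIl.
  have Ht : tau \in H by rewrite -cycle_subG joing_subr.
  have trM : [transitive M, on S | 'P] by apply/(mulB M sMP).
  have trH := connected_transitive hG sym_e hconn sHG (joing_subl _ _) Ht tx trM Sy.
  apply/trivgP/subsetP=> z Zz; apply/set1P/permP=> v; rewrite perm1.
  have [h Hh ->] := atransP2 trH (in_setT x) (in_setT v).
  have /(subsetP sZB)/setIP[/setIP[_ /astab1P]] : z ^ h^-1 \in Z.
    by rewrite memJ_norm // (subsetP nZH) ?groupV.
  rewrite /= /aperm => zx _; rewrite -{2}zx conjgE invgK.
  by rewrite !permM permKV.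
have pD : p %| #|(N :&: N :^ tau)%G| by rewrite /= Nt -edge_kernelE.
have [J [F [[nsJP nsFP sNF ltFX ltXJ] isoJF]]] := amalgam_reflections sBP nsNP sNB nsXP
  sNX XB_N XB_P nilXN Btau Ntau2 semiprim corefree hp pD.
have sJP := normal_sub nsJP; have sFJ := proper_sub (proper_trans ltFX ltXJ).
have isoJ : rho @* J / rho @* F \isog J / F.
  rewrite isog_sym; apply: morphim_quotient_isog.
  - exact: subset_trans sJP nSP.
  - exact: normalS sFJ sJP nsFP.
  by rewrite ker_restr_perm (subset_trans _ sNF) // setSI.
(* N is the kernel of [rho] on P, so strict inclusions above N survive. *)
have proper_rho (A1 A2 : {group {perm T}}) : A1 \proper A2 -> A2 \subset P -> N \subset A1 ->
    rho @* A1 \proper rho @* A2.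
  move=> ltA sA2P sNA1; have sA12 := proper_sub ltA.
  have sA2S := subset_trans sA2P nSP; rewrite properE morphimS //= morphimSK //.
  apply: contraL ltA => /subsetP sA21; rewrite properE sA12 negbK /=.
  apply/subsetP=> a A2a; have [k a1 kerk A1a1 defa] := mulsgP (sA21 a A2a).
  have Aa1 := subsetP sA12 _ A1a1; rewrite defa groupMr //; apply: (subsetP sNA1).
  apply/setIP; split; last by rewrite /= -/S -ker_restr_perm.
  by rewrite (subsetP sA2P) // -(groupMr _ Aa1) -defa.
exists (rho @* J)%G, (rho @* F)%G; split.
- exact: morphim_normal.
- exact: morphim_normal.
- by rewrite -rhoX proper_rho.
- by rewrite -rhoX proper_rho.
by case: isoJF => [[p2 [k k0 iso]] | [p3 [k k0 iso]]]; [left | right];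
  split=> //; exists k => //; apply: isog_trans isoJ iso.
Qed.
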